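(* Let $D\geq2$, let $p$ be prime, $m\geq1$, $R=\mathbb Z_{p^m}[\mathbb Z^D]$, and let $\mathbf f\in R^D$ be a regular sequence. Set $S:=R/(\mathbf f)$ and $$Q:=\operatorname{rank}_{\mathbb Z_{p^m}}S,\qquad \Lambda_S:=\bigl\{\mathbf v\in\mathbb Z^D:(x^{\mathbf v}-1)S=0\bigr\}.$$ For $1\leq j\leq D-1$ and every finite-index translation subgroup $\Lambda\subseteq\mathbb Z^D$, write $R_\Lambda:=\mathbb Z_{p^m}[\Lambda]$. Viewed as codes over $R_\Lambda$, $$\mathrm{KC}_j^{(D)}(\mathbf f;\mathbb Z_{p^m})\;\sim_{R_\Lambda,\mathrm{Cl},\mathrm{st}}\;\bigl[\mathrm{TC}_j^{(D)}(\mathbb Z_{p^m})\bigr]^{\oplus Q}$$ if and only if $\Lambda\subseteq\Lambda_S$, where $\mathrm{TC}_j^{(D)}(\mathbb Z_{p^m})$ denotes any degree-$j$ toric-code realization with trivial $\Lambda$-translation action on its $j$-th superselection layer.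
   Context: $R=\mathbb Z_{p^m}[x_1^{\pm1},\dots,x_D^{\pm1}]$, $x^{\mathbf v}=x_1^{v_1}\cdots x_D^{v_D}$ (translation by $\mathbf v$), with $\mathbb Z_{p^m}$-linear involution $\overline{x^{\mathbf v}}=x^{-\mathbf v}$; for a matrix, $\varphi^\dagger:=\overline{\varphi}^{\mathsf T}$. The same notation is used over $R_\Lambda$. For a module $M$, $\overline M$ is the same abelian group with action $r\ast m=\overline r\,m$, and $M^\dagger=\operatorname{Hom}(\overline M,A)$ over the ring $A$ in question. A sequence $(f_1,\dots,f_D)$ in $R$ is regular if $f_1$ is a non-zero-divisor in $R$ and, for $2\le i\le D$, $f_i$ is a non-zero-divisor in $R/(f_1,\dots,f_{i-1})$. For such a sequence of length $D$, $S$ is known to be a free $\mathbb Z_{p^m}$-module of finite rank, so $Q$ is defined. A translation-invariant CSS code over $A$ ($A=R$ or $R_\Lambda$) is a pair of matrices (maps of finite-rank free modules) $\varphi_X,\varphi_Z$ over $A$ with $\varphi_X^\dagger\varphi_Z=0$; it is topological if $\operatorname{im}\varphi_X=\ker\varphi_Z^\dagger$ and $\operatorname{im}\varphi_Z=\ker\varphi_X^\dagger$. Its $j$-th ($X$-sector) superselection layer is the $A$-module $\operatorname{Ext}_A^j(\overline{\operatorname{coker}\varphi_X},A)$, on which translations act through multiplication by monomials. The Koszul complex of $\mathbf f$ has $K_i(\mathbf f)=\bigwedge^iR^D$ and $\partial_i(e_{a_1}\wedge\cdots\wedge e_{a_i})=\sum_{k=1}^i(-1)^{k-1}f_{a_k}\,e_{a_1}\wedge\cdots\wedge\widehat{e_{a_k}}\wedge\cdots\wedge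 e_{a_i}$. The code $\mathrm{KC}_j^{(D)}(\mathbf f;\mathbb Z_{p^m})$ has $\varphi_X=\partial_j^\dagger:K_{j-1}^\dagger\to K_j^\dagger$ and $\varphi_Z=\partial_{j+1}:K_{j+1}\to K_j$. Toric-code realizations: the standard degree-$j$ toric code is $\mathrm{KC}_j^{(D)}(x_1-1,\dots,x_D-1;\mathbb Z_{p^m})$, i.e. the code with qudits on the $j$-cells of the hypercubic lattice and with $\varphi_X=\partial_j^\dagger$, $\varphi_Z=\partial_{j+1}$ given by the cellular boundary maps. The microscopic cellulation is not fixed: one may equally use the code built in the same way from the cellular chain complex of another bounded-geometry cellulation, provided it is related to the hypercubic one by a bounded-depth, uniformly local, $\Lambda$-periodic sequence of elementary cellular expansions and collapses. Viewing a code over $R_\Lambda$ means restriction of scalars: $R$ is a free $R_\Lambda$-module with basis $x^{\mathbf u}$, $\mathbf u$ running over coset representatives of $\Lambda$ in $\mathbb Z^D$, so matrices over $R$ become matrices over $R_\Lambda$. Stable Clifford equivalence over $A=R_\Lambda$: $\operatorname{E}_q(A)\subseteq\operatorname{GL}_q(A)$ is the subgroup generated by the matrices $I+rE_{i,k}$ with $r\in A$, $i\neq k$. For $\varphi,\varphi'$ of the same size $q\times a$, $\varphi\sim_{A,\mathrm{Cl}}\varphi'$ means $W\varphi\Phi=\varphi'$ for some $W\in\operatorname{E}_q(A)$, $\Phi\in\operatorname{GL}_a(A)$. For matrices of arbitrary sizes, $\varphi\sim_{A,\mathrm{Cl},\mathrm{st}}\varphi'$ means $\varphi\oplus I_\alpha\oplus0_{\beta,\eta}\sim_{A,\mathrm{Cl}}\varphi'\oplus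 I_{\alpha'}\oplus0_{\beta',\eta'}$ for some nonnegative integers $\alpha,\beta,\eta,\alpha',\beta',\eta'$, where $0_{\beta,\eta}$ is the $\beta\times\eta$ zero matrix. Two topological CSS codes are related by $\sim_{A,\mathrm{Cl},\mathrm{st}}$ if their maps $\varphi_X$ are. The superscript $\oplus Q$ means the direct sum of $Q$ copies. *)

(* Defs.v *)
From HB Require Import structures.
From mathcomp Require Import all_boot all_order all_algebra.
From mathcomp Require Import finmap.
From mathcomp Require Import monalg.
From Stdlib Require Import Relation_Operators.

Set Implicit Arguments.
Unset Strict Implicit.
Unset Printing Implicit Defensive.

Import GRing.Theory Num.Theory.

Local Open Scope ring_scope.

Lemma morphB0 (U V : zmodType) (F : U -> V) :
  {morph F : a b / a - b} -> F 0 = 0.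
Proof. by move=> FB; have := FB 0 0; rewrite !subrr. Qed.

Lemma morphBD (U V : zmodType) (F : U -> V) :
  {morph F : a b / a - b} -> {morph F : a b / a + b}.
Proof.
move=> FB a b; have FN : F (- b) = - F b by rewrite -(sub0r b) FB (morphB0 FB) sub0r.
by rewrite -[in LHS](opprK b) FB FN opprK.
Qed.

Definition galg (K : comNzRingType) (G : zmodType) : Type := {malg K[G]}.

HB.instance Definition _ (K : comNzRingType) (G : zmodType) :=
  GRing.Lmodule.copy (galg K G) {malg K[G]}.

(* The monomial x^v. *)
HB.lock Definition mon (K : comNzRingType) (G : zmodType) (v : G) : galg K G :=
  << (1 : K) *g v >>.
Canonical mon_unlockable := Unlockable mon.unlock.

HB.lock Definition galg_mul (K : comNzRingType) (G : zmodType)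
    (g1 g2 : galg K G) : galg K G :=
  \sum_(v <- msupp g1) \sum_(w <- msupp g2) << g1@_v * g2@_w *g v + w >>.
Canonical galg_mul_unlockable := Unlockable galg_mul.unlock.

Arguments mon K {G} v.

Section GroupAlgebra.
Variables (K : comNzRingType) (G : zmodType).
Implicit Types g : galg K G.

Lemma monE v : mon K v = << (1 : K) *g v >> :> galg K G.
Proof. by rewrite unlock. Qed.

Definition gsum (V : zmodType) (h : K -> G -> V) g : V :=
  \sum_(v <- msupp g) h g@_v v.

Lemma gsumEw (V : zmodType) (h : K -> G -> V) (d : {fset G}) g :
  (forall v, h 0 v = 0) -> (msupp g `<=` d)%fset ->
  gsum h g = \sum_(v <- d) h g@_v v.
Proof.
move=> h0 le; rewrite /gsum (big_fset_incl _ le) => //= x xd /mcoeff_outdom ->.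
exact: h0.
Qed.

Lemma gsumB (V : zmodType) (h : K -> G -> V) :
  (forall v, {morph h^~ v : a b / a - b}) -> {morph gsum h : a b / a - b}.
Proof.
move=> hB a b.
have h0 v : h 0 v = 0 by have := hB v 0 0; rewrite /= !subrr.
pose d := (msupp a `|` msupp b)%fset.
rewrite (@gsumEw _ h d (a - b)) ?(@gsumEw _ h d a) ?(@gsumEw _ h d b) //.
- by rewrite -sumrB; apply: eq_bigr => v _; rewrite mcoeffB; apply: (hB v).
- exact: fsubsetUr.
- exact: fsubsetUl.
- exact: msuppB_le.
Qed.

Lemma gsumU (V : zmodType) (h : K -> G -> V) c v :
  (forall v, h 0 v = 0) -> gsum h (<< c *g v >> : galg K G) = h c v.
Proof.
by move=> h0; rewrite (gsumEw h0 (msuppU_le)) big_seq_fset1 mcoeffUU.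
Qed.

Lemma galg_ext (V : zmodType) (F H : galg K G -> V) :
  {morph F : a b / a - b} -> {morph H : a b / a - b} ->
  (forall c v, F << c *g v >> = H << c *g v >>) -> F =1 H.
Proof.
move=> FB HB FH g.
rewrite [g]monalgE (big_morph F (morphBD FB) (morphB0 FB)).
rewrite (big_morph H (morphBD HB) (morphB0 HB)).
by apply: eq_bigr => v _; apply: FH.
Qed.

Lemma galg_mulBl g : {morph (@galg_mul K G)^~ g : a b / a - b}.
Proof.
move=> a b; rewrite !galg_mul.unlock.
apply: (@gsumB _ (fun c v => \sum_(w <- msupp g) << c * g@_w *g v + w >>)).
move=> v c c'; rewrite -sumrB; apply: eq_bigr => w _.
by rewrite mulrBl monalgUB.
Qed.

Lemma galg_mulC : commutative (@galg_mul K G).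
Proof.
move=> a b; rewrite !galg_mul.unlock exchange_big; apply: eq_bigr => v _.
by apply: eq_bigr => w _; rewrite mulrC addrC.
Qed.

Lemma galg_mulBr g : {morph galg_mul g : a b / a - b}.
Proof. by move=> a b; rewrite !(galg_mulC g) galg_mulBl. Qed.

Lemma galg_mulUU c d v w :
  @galg_mul K G << c *g v >> << d *g w >> = << c * d *g v + w >>.
Proof.
have := @gsumU _ (fun c v => \sum_(w' <- msupp (<< d *g w >> : galg K G))
  << c * (<< d *g w >> : galg K G)@_w' *g v + w' >>) c v.
rewrite /gsum galg_mul.unlock => -> //.
  have := @gsumU _ (fun d w => << c * d *g v + w >>) d w.
  by rewrite /gsum => -> // u; rewrite mulr0 monalgU0.
by move=> u; rewrite big1 // => ? _; rewrite mul0r monalgU0.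
Qed.

Lemma galg_mulA : associative (@galg_mul K G).
Proof.
move=> a b c; move: a.
apply: galg_ext => [x y|x y|e u]; rewrite ?galg_mulBl //.
move: b; apply: galg_ext => [x y|x y|d v]; rewrite ?(galg_mulBl, galg_mulBr) //.
move: c; apply: galg_ext => [x y|x y|c w]; rewrite ?(galg_mulBl, galg_mulBr) //.
by rewrite !galg_mulUU mulrA addrA.
Qed.

Lemma galg_mul1 : left_id (mon K 0) (@galg_mul K G).
Proof.
apply: galg_ext => [x y|x y|d v]; rewrite ?galg_mulBr //.
by rewrite monE galg_mulUU mul1r add0r.
Qed.

Lemma galg_mulDl : left_distributive (@galg_mul K G) +%R.
Proof.
by move=> a b g; rewrite (morphBD (@galg_mulBl g)).
Qed.

Lemma galg_1neq0 : mon K 0 != 0 :> galg K G.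
Proof. by rewrite monE monalgU_eq0 oner_eq0. Qed.

HB.instance Definition _ := GRing.Zmodule_isComNzRing.Build (galg K G)
  galg_mulA galg_mulC galg_mul1 galg_mulDl galg_1neq0.

Lemma mon0 : mon K 0 = 1 :> galg K G.
Proof. by []. Qed.

Lemma galgUU c d v w :
  (<< c *g v >> : galg K G) * << d *g w >> = << c * d *g v + w >>.
Proof. exact: galg_mulUU. Qed.

Lemma galg_scaleE c g : c *: g = (<< c *g 0 >> : galg K G) * g.
Proof.
move: g; apply: galg_ext => [a b|a b|d v]; rewrite ?scalerBr ?mulrBr //.
rewrite galgUU add0r; apply/malgP => w.
by rewrite mcoeffZ !mcoeffU mulrnAr.
Qed.

Lemma galg_ext2 (V : zmodType) (F H : galg K G -> galg K G -> V) :
  (forall g, {morph F^~ g : a b / a - b}) -> (forall g, {morph F g : a b / a - b}) ->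
  (forall g, {morph H^~ g : a b / a - b}) -> (forall g, {morph H g : a b / a - b}) ->
  (forall c d v w, F << c *g v >> << d *g w >> = H << c *g v >> << d *g w >>) ->
  F =2 H.
Proof.
move=> F1 F2 H1 H2 FH a b; move: a.
apply: galg_ext => [x y|x y|e u]; rewrite ?F1 ?H1 //.
by move: b; apply: galg_ext => [x y|x y|d v]; rewrite ?F2 ?H2.
Qed.

(* The involution x^v |-> x^(-v). *)
Definition gbar g : galg K G := \sum_(v <- msupp g) << g@_v *g - v >>.

Lemma gbarB : {morph gbar : a b / a - b}.
Proof.
by apply: (@gsumB _ (fun c v => << c *g - v >>)) => v a b; rewrite monalgUB.
Qed.

Lemma gbarU c v : gbar << c *g v >> = << c *g - v >>.
Proof.
by apply: (@gsumU _ (fun c v => << c *g - v >>)) => u; rewrite monalgU0.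
Qed.

Lemma gbar_mon v : gbar (mon K v) = mon K (- v).
Proof. by rewrite !monE gbarU. Qed.

Lemma gbar_monoid : monoid_morphism gbar.
Proof.
split; first by rewrite -mon0 monE gbarU oppr0.
move=> a b; move: a b; apply: galg_ext2 => [g a b|g a b|g a b|g a b|c d v w].
- by rewrite mulrBl gbarB.
- by rewrite mulrBr gbarB.
- by rewrite gbarB mulrBl.
- by rewrite gbarB mulrBr.
by rewrite galgUU !gbarU galgUU opprD.
Qed.

HB.instance Definition _ := GRing.isZmodMorphism.Build _ _ gbar gbarB.
HB.instance Definition _ := GRing.isMonoidMorphism.Build _ _ gbar gbar_monoid.

Lemma gbarK : involutive gbar.
Proof.
apply: galg_ext => [a b|a b|c v]; rewrite ?gbarB //.
by rewrite !gbarU opprK.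
Qed.

Definition dag m n (M : 'M[galg K G]_(m, n)) : 'M_(n, m) := (map_mx gbar M)^T.

Lemma dagM m n l (M : 'M[galg K G]_(m, n)) (N : 'M_(n, l)) :
  dag (M *m N) = dag N *m dag M.
Proof. by rewrite /dag map_mxM trmx_mul. Qed.

Lemma dagK m n (M : 'M[galg K G]_(m, n)) : dag (dag M) = M.
Proof. by apply/matrixP => i j; rewrite !mxE gbarK. Qed.

End GroupAlgebra.

Notation laurent K D := (galg K 'rV[int]_D).

(* Change of coefficients along the canonical map from the integers. *)
Section Coefficients.
Variables (K : comNzRingType) (G : zmodType).

Definition gcoef (g : galg int G) : galg K G :=
  \sum_(v <- msupp g) << (g@_v)%:~R *g v >>.

Lemma gcoefB : {morph gcoef : a b / a - b}.
Proof.
apply: (@gsumB _ _ _ (fun c v => << (c%:~R : K) *g v >> : galg K G)) => v a b.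
by rewrite rmorphB monalgUB.
Qed.

Lemma gcoefU c v : gcoef << c *g v >> = << c%:~R *g v >>.
Proof.
apply: (@gsumU _ _ _ (fun c v => << (c%:~R : K) *g v >> : galg K G)) => u.
by rewrite monalgU0.
Qed.

Lemma gcoef_mon v : gcoef (mon int v) = mon K v.
Proof. by rewrite !monE gcoefU. Qed.

Lemma gcoef_monoid : monoid_morphism gcoef.
Proof.
split; first by rewrite -!mon0 !monE gcoefU.
move=> a b; move: a b; apply: galg_ext2 => [g a b|g a b|g a b|g a b|c d v w].
- by rewrite mulrBl gcoefB.
- by rewrite mulrBr gcoefB.
- by rewrite gcoefB mulrBl.
- by rewrite gcoefB mulrBr.
by rewrite galgUU !gcoefU galgUU rmorphM.
Qed.

HB.instance Definition _ := GRing.isZmodMorphism.Build _ _ gcoef gcoefB.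
HB.instance Definition _ := GRing.isMonoidMorphism.Build _ _ gcoef gcoef_monoid.

End Coefficients.

Section Codes.
Variables (K : comNzRingType) (G : zmodType).
Local Notation A := (galg K G).

Record css_code := CSSCode {
  cs_q : nat; cs_a : nat; cs_b : nat;
  cs_X : 'M[A]_(cs_q, cs_a);
  cs_Z : 'M[A]_(cs_q, cs_b);
  cs_orth : dag cs_X *m cs_Z = 0 }.

Definition diag_copies Q m n (M : 'M[A]_(m, n)) :
    'M[A]_(\sum_(i < Q) m, \sum_(i < Q) n) :=
  \mxblock_(i < Q, k < Q) (if i == k then M else 0).

Lemma diag_copies_orth Q q a b (X : 'M[A]_(q, a)) (Z : 'M[A]_(q, b)) :
  dag X *m Z = 0 -> dag (diag_copies Q X) *m diag_copies Q Z = 0.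
Proof.
move=> XZ; rewrite /diag_copies.
have -> : dag (\mxblock_(i < Q, k < Q) (if i == k then X else 0)) =
          \mxblock_(i < Q, k < Q) (if i == k then dag X else 0).
  apply/matrixP => s t; rewrite !mxE eq_sym.
  by case: ifP => _; rewrite !mxE ?rmorph0.
rewrite mul_mxblock -[RHS]mxblock0; apply: eq_mxblock => i k.
rewrite big1 // => l _; case: eqP => _; last by rewrite mul0mx.
by case: eqP => _; rewrite ?mulmx0.
Qed.

Definition css_copies Q (C : css_code) : css_code :=
  CSSCode (diag_copies_orth Q (cs_orth C)).

(* Products of the I + r E_ik; these form a group, since I - r E_ik is the
   inverse of I + r E_ik. *)
Inductive elementary q : 'M[A]_q -> Prop :=
| Elementary1 : elementary 1%:M
| ElementaryM r (i k : 'I_q) M :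
    i != k -> elementary M -> elementary ((1%:M + r *: delta_mx i k) *m M).

Definition in_GL a (M : 'M[A]_a) :=
  exists N : 'M[A]_a, M *m N = 1%:M /\ N *m M = 1%:M.

Definition clifford_equiv q a (M M' : 'M[A]_(q, a)) :=
  exists (W : 'M[A]_q) (F : 'M[A]_a),
    [/\ elementary W, in_GL F & W *m M *m F = M'].

Definition stabilize q a (M : 'M[A]_(q, a)) alpha beta eta :
    'M[A]_(q + alpha + beta, a + alpha + eta) :=
  block_mx (block_mx M 0 0 1%:M) 0 0 0.

(* The casts only record that the two stabilized matrices have equal sizes. *)
Definition stable_clifford_equiv q a q' a'
    (M : 'M[A]_(q, a)) (M' : 'M[A]_(q', a')) :=
  exists alpha beta eta alpha' beta' eta' : nat,
  exists (eq_q : (q + alpha + beta = q' + alpha' + beta')%N)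
         (eq_a : (a + alpha + eta = a' + alpha' + eta')%N),
    clifford_equiv (castmx (eq_q, eq_a) (stabilize M alpha beta eta))
                   (stabilize M' alpha' beta' eta').

Definition code_equiv (C C' : css_code) :=
  stable_clifford_equiv (cs_X C) (cs_X C').

(* A resolution ... -> F_2 -> F_1 -> F_0 -> coker psi -> 0 by free modules of
   finite rank; [fr_d i] is the map F_i -> F_(i-1), with 0 for the map out of
   F_0, and [fr_aug] lifts F_0 -> coker psi to the codomain of psi. *)
Record free_resolution q a (psi : 'M[A]_(q, a)) := FreeResolution {
  fr_rank : nat -> nat;
  fr_aug : 'M[A]_(q, fr_rank 0);
  fr_d : forall i, 'M[A]_(fr_rank i.-1, fr_rank i);
  fr_d0 : fr_d 0 = 0;
  fr_onto : forall y : 'cV[A]_q, exists x z, y = fr_aug *m x + psi *m z;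
  fr_exact0 : forall x : 'cV[A]_(fr_rank 0),
    (exists z, fr_aug *m x = psi *m z) <-> (exists y, x = fr_d 1 *m y);
  fr_exact : forall i (x : 'cV[A]_(fr_rank i.+1)),
    fr_d i.+1 *m x = 0 <-> exists y, x = fr_d i.+2 *m y }.

Definition ext_cocycle q a (psi : 'M[A]_(q, a)) (F : free_resolution psi) j
    (w : 'rV[A]_(fr_rank F j)) := w *m fr_d F j.+1 = 0.

Definition ext_coboundary q a (psi : 'M[A]_(q, a)) (F : free_resolution psi) j
    (w : 'rV[A]_(fr_rank F j)) := exists w', w = w' *m fr_d F j.

(* x^v acts as the identity on Ext^j(coker psi, A) for all v; as Ext does not
   depend on the resolution, one of them is enough. *)
Definition ext_trivial_action j q a (psi : 'M[A]_(q, a)) :=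
  exists F : free_resolution psi, forall v (w : 'rV_(fr_rank F j)),
    ext_cocycle w -> ext_coboundary ((mon K v - 1) *: w).

(* The entrywise involution identifies the conjugate module of coker phi_X with
   the cokernel of the conjugate matrix. *)
Definition trivial_superselection_layer j (C : css_code) :=
  ext_trivial_action j (map_mx (@gbar K G) (cs_X C)).

End Codes.

Section Koszul.
Variables (R : comNzRingType) (D : nat).
Implicit Types (f : 'I_D -> R) (A B : {set 'I_D}).

Definition in_ideal f r := exists g : 'I_D -> R, r = \sum_k g k * f k.

Definition in_ideal_before f (i : 'I_D) r :=
  exists g : 'I_D -> R, r = \sum_(k < D | (k < i)%N) g k * f k.

Definition regular_sequence f :=
  forall (i : 'I_D) r, in_ideal_before f i (f i * r) -> in_ideal_before f i r.

Definition kosz_basis i := [set A : {set 'I_D} | #|A| == i].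
Definition kosz_rank i := #|kosz_basis i|.

Definition kosz_sign A (a : 'I_D) : R := (-1) ^+ #|[set c in A | (c < a)%N]|.

(* Coefficient of e_B in the boundary of e_A, where e_A is the wedge of the e_a,
   a in A, in increasing order. *)
Definition kosz_coef f B A : R :=
  \sum_(a in A | A :\ a == B) kosz_sign A a * f a.

(* The boundary K_i -> K_(i-1); it is 0 for i = 0. *)
Definition koszul f i : 'M[R]_(kosz_rank i.-1, kosz_rank i) :=
  \matrix_(s, t) kosz_coef f (enum_val s) (enum_val t).

Lemma koszul0 f : koszul f 0 = 0.
Proof.
apply/matrixP => s t; rewrite !mxE /kosz_coef big1 // => a /andP[].
have := enum_valP t; rewrite inE cards_eq0 => /eqP ->.
by rewrite inE.
Qed.

Lemma eq_koszul f f' i : f =1 f' -> koszul f i = koszul f' i.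
Proof.
move=> ff'; apply/matrixP => s t; rewrite !mxE; apply: eq_bigr => a _.
by rewrite ff'.
Qed.

Lemma kosz_sign_swap A a b : a \in A -> b \in A -> (a < b)%N ->
  kosz_sign (A :\ b) a * kosz_sign A b = - (kosz_sign (A :\ a) b * kosz_sign A a).
Proof.
move=> aA bA ab; rewrite /kosz_sign.
have -> : [set c in A :\ b | (c < a)%N] = [set c in A | (c < a)%N].
  apply/setP => c; rewrite !inE -andbA; case: eqP => //= ->.
  by rewrite [(b < a)%N]ltnNge ltnW // andbF.
have -> : [set c in A :\ a | (c < b)%N] = [set c in A | (c < b)%N] :\ a.
  by apply/setP => c; rewrite !inE andbA.
rewrite (cardsD1 a [set c in A | (c < b)%N]) inE aA ab /= add1n exprS mulN1r.
by rewrite mulrN mulrC.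
Qed.

Lemma koszul_koszul f i : koszul f i *m koszul f i.+1 = 0.
Proof.
case: i => [|i]; first by rewrite koszul0 mul0mx.
apply/matrixP => s t; rewrite !mxE.
set B := enum_val s; set A := enum_val t.
have cA : #|A| = i.+2 by have := enum_valP t; rewrite inE => /eqP.
pose F a b := (kosz_sign (A :\ b) a * kosz_sign A b) * (f a * f b).
pose P a b := [&& a \in A, b \in A, a != b & A :\ b :\ a == B].
have -> : \sum_k koszul f i.+1 s k * koszul f i.+2 k t
        = \sum_(b : 'I_D) \sum_(a : 'I_D | P a b) F a b.
  under eq_bigr do rewrite !mxE.
  have -> : \sum_(k < kosz_rank i.+2.-1) kosz_coef f B (enum_val k) * kosz_coef f (enum_val k) A
     = \sum_(C in kosz_basis i.+1) kosz_coef f B C * kosz_coef f C A.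
    by rewrite [RHS]big_enum_val.
  under eq_bigr do rewrite [kosz_coef f _ A]/kosz_coef mulr_sumr big_mkcond /=.
  rewrite exchange_big; apply: eq_bigr => b _ /=.
  rewrite -big_mkcondr /=.
  case bA: (b \in A); last first.
    rewrite !big_pred0 // => x; first by rewrite /P bA andbF.
    by rewrite andbF.
  rewrite (big_pred1 (A :\ b)); last first.
    move=> C; rewrite /= inE eq_sym [A :\ b == C]eq_sym.
    apply/andP/eqP => [[_ /eqP ->]|->] //; split=> //.
    by rewrite eq_sym; have := cardsD1 b A; rewrite bA cA add1n => -[->].
  rewrite /kosz_coef mulr_suml; apply: eq_big => [a|a _].
    by rewrite /P bA !inE /=; case: (a == b); case: (a \in A).
  by rewrite /F mulrACA.
have FC a b : P a b -> (a < b)%N -> F a b = - F b a.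
  move=> /and4P[aA bA _ _] ab.
  by rewrite /F kosz_sign_swap // mulNr [f b * f a]mulrC.
have PC a b : P a b = P b a.
  rewrite /P eq_sym; case: (a \in A); case: (b \in A) => //=.
  by rewrite !setDDl setUC.
pose S := \sum_b \sum_(a | P a b && (a < b)%N) F a b.
have -> : \sum_b \sum_(a | P a b) F a b =
    S + \sum_b \sum_(a | P a b && (b < a)%N) F a b.
  rewrite /S -big_split; apply: eq_bigr => b _ /=.
  rewrite (bigID (fun a : 'I_D => (a < b)%N)) /=; congr (_ + _).
  apply: eq_bigl => a; rewrite -leqNgt /P.
  case: (eqVneq a b) => [->|nab]; rewrite ?andbF //.
  by rewrite [(b <= a)%N]leq_eqVlt val_eqE [b == a]eq_sym (negPf nab).
suff -> : \sum_b \sum_(a | P a b && (b < a)%N) F a b = - S by rewrite subrr.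
rewrite (exchange_big_dep predT) //= /S -sumrN; apply: eq_bigr => b _.
rewrite -sumrN; apply: eq_big => [a|a /andP[Pba ab]].
  by rewrite (PC b a).
by rewrite (FC a b) ?opprK // PC.
Qed.

End Koszul.

Lemma map_koszul (R R' : comNzRingType) D (h : {rmorphism R -> R'})
    (f : 'I_D -> R) i :
  map_mx h (koszul f i) = koszul (fun k => h (f k)) i.
Proof.
apply/matrixP => s t; rewrite !mxE rmorph_sum /=; apply: eq_bigr => a _.
by rewrite rmorphM /kosz_sign rmorph_sign.
Qed.

Lemma koszul_code_orth (K : comNzRingType) D (f : 'I_D -> laurent K D) j :
  dag (dag (koszul f j)) *m koszul f j.+1 = 0.
Proof. by rewrite dagK koszul_koszul. Qed.

Definition koszul_code (K : comNzRingType) D (f : 'I_D -> laurent K D) j :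
  css_code K 'rV[int]_D := CSSCode (koszul_code_orth f j).

Section Quotient.
Variables (K : comNzRingType) (D : nat) (f : 'I_D -> laurent K D).

(* S = R/(f) is a free K-module of rank Q. *)
Definition quotient_free_rank Q :=
  exists b : 'I_Q -> laurent K D, forall r,
    exists! c : {ffun 'I_Q -> K}, in_ideal f (r - \sum_i c i *: b i).

(* (x^v - 1) S = 0. *)
Definition quotient_trivial_translation (v : 'rV[int]_D) :=
  forall r, in_ideal f ((mon K v - 1) * r).

End Quotient.

(* A subgroup L of V as a group in its own right. *)
Section Sublattice.
Variables (V : zmodType) (L : zmodClosed V).

Record sublattice := Sublattice { sub_val :> V; _ : sub_val \in L }.

HB.instance Definition _ := [isSub for sub_val].
HB.instance Definition _ := [Choice of sublattice by <:].
HB.instance Definition _ := [SubChoice_isSubZmodule of sublattice by <:].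

(* A finite family of coset representatives; there is one exactly when L has
   finite index. *)
Record coset_reps := CosetReps {
  cr_index : nat;
  cr_rep : 'I_cr_index -> V;
  cr_repP : forall v, exists! i, v - cr_rep i \in L }.

Variables (T : coset_reps) (K : comNzRingType).
Local Notation N := (cr_index T).
Local Notation u := (@cr_rep T).

(* Multiplication by x^v in the K[L]-basis x^(u_i) of K[V]: column k has x^l in
   row i when v + u_k = u_i + l. *)
Definition transl_mx (v : V) : 'M[galg K sublattice]_N :=
  \matrix_(i, k) if insub (v + u k - u i) is Some l then mon K l else 0.

Definition res_elt (r : galg K V) : 'M[galg K sublattice]_N :=
  \sum_(v <- msupp r)
    \matrix_(i, k) (r@_v *: transl_mx v i k).

Definition res_mx m n (M : 'M[galg K V]_(m, n)) :
    'M[galg K sublattice]_(\sum_(i < m) N, \sum_(k < n) N) :=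
  \mxblock_(i < m, k < n) res_elt (M i k).

Lemma cr_rep_eq i k : u i - u k \in L -> i = k.
Proof.
move=> h; have [l [hl lu]] := cr_repP T (u i).
by rewrite -(lu i) ?subrr ?rpred0 // (lu k).
Qed.

Lemma transl_mxP v k : exists i (l : sublattice),
  v + u k = u i + val l /\ forall i', transl_mx v i' k = mon K l *+ (i' == i).
Proof.
have [i [iL iu]] := cr_repP T (v + u k).
exists i, (Sublattice iL); split; first by rewrite /= [RHS]addrC subrK.
move=> i'; rewrite mxE; case: insubP => [l lL lE|nL].
  have := iu i' lL => ii; rewrite -ii eqxx mulr1n; congr mon.
  by apply: val_inj; rewrite lE /= ii.
by case: eqP => // ii; rewrite ii iL in nL.
Qed.

Lemma transl_mx0 : transl_mx 0 = 1%:M.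
Proof.
apply/matrixP => i k; have [i0 [l [E ->]]] := transl_mxP 0 k.
have i0k : i0 = k.
  apply: cr_rep_eq; rewrite -[u i0](addrK (val l)) -E add0r.
  by rewrite addrAC subrr add0r rpredN; apply: valP.
have l0 : l = 0.
  by apply: val_inj; apply: (addrI (u i0)); rewrite -E i0k add0r addr0.
by rewrite i0k l0 !mxE.
Qed.

Lemma monD (G : zmodType) (v w : G) : mon K (v + w) = mon K v * mon K w.
Proof. by rewrite !monE galgUU mulr1. Qed.

Lemma transl_mxM v w : transl_mx (v + w) = transl_mx v *m transl_mx w.
Proof.
apply/matrixP => i k; rewrite [RHS]mxE.
have [i1 [l1 [E1 H1]]] := transl_mxP w k.
have [i2 [l2 [E2 H2]]] := transl_mxP v i1.
have [i3 [l3 [E3 ->]]] := transl_mxP (v + w) k.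
rewrite (bigD1 i1) //= H1 eqxx mulr1n big1 ?addr0; last first.
  by move=> k' /negPf nk; rewrite H1 nk mulr0.
have E : u i3 + val l3 = u i2 + (val l2 + val l1).
  by rewrite -E3 -addrA E1 addrA E2 addrA.
have i32 : i3 = i2.
  apply: cr_rep_eq; rewrite -[u i3](addrK (val l3)) E.
  rewrite -(addrA (u i2)) (addrC (u i2)) addrK.
  by rewrite rpredB ?rpredD //; apply: valP.
have l32 : l3 = l2 + l1.
  by apply: val_inj; apply: (addrI (u i3)); rewrite E i32.
by rewrite i32 H2 l32 monD mulrnAl.
Qed.

Lemma res_eltB : {morph res_elt : a b / a - b}.
Proof.
apply: (@gsumB _ _ _
  (fun c v => \matrix_(i, k) (c *: transl_mx v i k))) => v a b.
by apply/matrixP => i k; rewrite !mxE scalerBl.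
Qed.

Lemma res_eltU c v :
  res_elt << c *g v >> = (<< c *g 0 >> : galg K sublattice) *: transl_mx v.
Proof.
have := @gsumU _ _ _
  (fun c v => \matrix_(i, k) (c *: transl_mx v i k)) c v.
rewrite /gsum /res_elt => ->.
  by apply/matrixP => i k; rewrite !mxE galg_scaleE.
by move=> w; apply/matrixP => i k; rewrite !mxE scale0r.
Qed.

Lemma res_eltM a b : res_elt (a * b) = res_elt a *m res_elt b.
Proof.
move: a b; apply: galg_ext2 => [g a b|g a b|g a b|g a b|c d v w].
- by rewrite mulrBl res_eltB.
- by rewrite mulrBr res_eltB.
- by rewrite res_eltB mulmxBl.
- by rewrite res_eltB mulmxBr.
rewrite galgUU !res_eltU -scalemxAl -scalemxAr scalerA transl_mxM galgUU.
by rewrite addr0.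
Qed.

Lemma res_elt0 : res_elt 0 = 0.
Proof. exact: morphB0 res_eltB. Qed.

Lemma res_elt_mon v : res_elt (mon K v) = transl_mx v.
Proof. by rewrite monE res_eltU -monE mon0 scale1r. Qed.

Lemma res_elt1 : res_elt 1 = 1%:M.
Proof. by rewrite -mon0 res_elt_mon transl_mx0. Qed.

Lemma res_elt_bar a : res_elt (gbar a) = dag (res_elt a).
Proof.
move: a; apply: galg_ext => [a b|a b|c v].
- by rewrite gbarB res_eltB.
- by rewrite res_eltB /dag map_mxB linearB.
rewrite gbarU !res_eltU; apply/matrixP => i k; rewrite !mxE rmorphM /= gbarU oppr0.
congr (_ * _).
have -> : v + u i - u k = - (- v + u k - u i) by rewrite !opprD !opprK addrAC.
case: insubP => [l lL lE|nL]; case: insubP => [l' lL' lE'|nL'].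
- by rewrite gbar_mon; congr mon; apply: val_inj; rewrite /= lE' lE opprK.
- by rewrite rpredN lL in nL'.
- by rewrite rpredN (negPf nL) in lL'.
- by rewrite rmorph0.
Qed.

Lemma res_mxM m n l (M : 'M[galg K V]_(m, n)) (M' : 'M_(n, l)) :
  res_mx (M *m M') = res_mx M *m res_mx M'.
Proof.
rewrite /res_mx mul_mxblock; apply: eq_mxblock => i k; rewrite mxE.
rewrite (big_morph res_elt (morphBD res_eltB) res_elt0).
by apply: eq_bigr => s _; apply: res_eltM.
Qed.

Lemma res_mx0 m n : res_mx (0 : 'M_(m, n)) = 0.
Proof.
rewrite /res_mx -[RHS]mxblock0; apply: eq_mxblock => i k.
by rewrite mxE res_elt0.
Qed.

Lemma res_mx_dag m n (M : 'M[galg K V]_(m, n)) : res_mx (dag M) = dag (res_mx M).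
Proof.
apply/matrixP => s t; rewrite !mxE res_elt_bar.
by rewrite !mxE.
Qed.

Lemma res_code_orth (C : css_code K V) :
  dag (res_mx (cs_X C)) *m res_mx (cs_Z C) = 0.
Proof. by rewrite -res_mx_dag -res_mxM cs_orth res_mx0. Qed.

Definition res_code (C : css_code K V) : css_code K sublattice :=
  CSSCode (res_code_orth C).

End Sublattice.

(* Cellular chain complex of a cell complex on which G acts freely, with
   finitely many orbits of cells in each dimension.  Representatives of the
   orbits of k-cells, with an orientation, are indexed by 'I_(pc_rank k), and
   row i, column c of [pc_bd k] collects the incidence numbers of the cell c of
   dimension k with the translates of the cell i of dimension k - 1.  The map out
   of dimension 0 is 0, and an edge has two (possibly equal) end points. *)
Record periodic_complex (G : zmodType) := PeriodicComplex {
  pc_rank : nat -> nat;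
  pc_bd : forall k, 'M[galg int G]_(pc_rank k.-1, pc_rank k);
  pc_bd0 : pc_bd 0 = 0;
  pc_bd_bd : forall k, pc_bd k *m pc_bd k.+1 = 0;
  pc_edge : forall c : 'I_(pc_rank 1), exists (a b : 'I_(pc_rank 0)) (v w : G),
    forall i, pc_bd 1 i c = mon int v *+ (i == a) - mon int w *+ (i == b) }.

Section Cellulations.
Variable G : zmodType.
Implicit Types C : periodic_complex G.

(* A single translated cell, with either orientation. *)
Definition signed_translate (s : galg int G) :=
  exists (e : bool) (v : G), s = (-1) ^+ e * mon int v.

(* M sends each cell b to a signed translate of the cell iota b. *)
Definition cell_injection m n (iota : 'I_n -> 'I_m) (M : 'M[galg int G]_(m, n)) :=
  injective iota /\
  forall b, exists2 s, signed_translate s & forall a, M a b = s *+ (a == iota b).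

(* C' is obtained from its subcomplex C by adding one orbit of k-cells e and one
   orbit of (k+1)-cells e', e being a face of e' with incidence number 1 or -1
   and of no other cell: the elementary expansion along (e, e') and its
   translates, whose inverse is an elementary collapse.  Since C is a subcomplex,
   no cell of C has e in its boundary.  Re-choosing orientations and orbit
   representatives of cells of C is allowed. *)
Definition elementary_expansion C C' :=
  exists k (iota : forall i, 'I_(pc_rank C i) -> 'I_(pc_rank C' i))
           (J : forall i, 'M_(pc_rank C' i, pc_rank C i))
           (e : 'I_(pc_rank C' k)) (e' : 'I_(pc_rank C' k.+1)),
    [/\ forall i, pc_rank C' i = (pc_rank C i + (i == k) + (i == k.+1))%N,
        forall i, cell_injection (iota i) (J i),
        forall i, pc_bd C' i *m J i = J i.-1 *m pc_bd C i,
        e \notin codom (iota k) /\ e' \notin codom (iota k.+1)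
      & signed_translate (pc_bd C' k.+1 e e')].

(* A finite sequence of G-periodic steps, each of which changes finitely many
   orbits, has bounded depth and is uniformly local. *)
Definition expansion_collapse_equiv : periodic_complex G -> periodic_complex G -> Prop :=
  clos_refl_sym_trans _ elementary_expansion.

Lemma cell_code_orth K C j :
  dag (dag (map_mx (@gcoef K G) (pc_bd C j))) *m map_mx (@gcoef K G) (pc_bd C j.+1)
  = 0.
Proof. by rewrite dagK -map_mxM pc_bd_bd map_mx0. Qed.

(* The code with qudits on the j-cells. *)
Definition cell_code (K : comNzRingType) C j : css_code K G :=
  CSSCode (cell_code_orth K C j).

End Cellulations.

Section Hypercubic.
Variables (D : nat) (L : zmodClosed 'rV[int]_D) (T : coset_reps L).

Definition toric_seq (K : comNzRingType) (k : 'I_D) : laurent K D :=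
  mon K (delta_mx 0 k) - 1.

Definition hyper_bd k := res_mx T (koszul (toric_seq int) k).

Lemma hyper_bd0 : hyper_bd 0 = 0.
Proof. by rewrite /hyper_bd koszul0 res_mx0. Qed.

Lemma hyper_bd_bd k : hyper_bd k *m hyper_bd k.+1 = 0.
Proof. by rewrite -res_mxM koszul_koszul res_mx0. Qed.

Lemma hyper_edge c : exists a b (v w : sublattice L),
  forall i, hyper_bd 1 i c = mon int v *+ (i == a) - mon int w *+ (i == b).
Proof.
set k := tagnat.sig1 c; set u := tagnat.sig2 c.
have /cards1P[x Ax] : #|enum_val k| == 1%N.
  by have := enum_valP k; rewrite inE.
have set0P (i : 'I_(kosz_rank D 0)) : enum_val i = set0.
  by have := enum_valP i; rewrite inE cards_eq0 => /eqP.
have r0 : (0 < kosz_rank D 0)%N.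
  by apply/card_gt0P; exists set0; rewrite inE cards0.
pose i0 : 'I_(kosz_rank D 0) := Ordinal r0.
have i0P i : i = i0 by apply: enum_val_inj; rewrite !set0P.
have coef i : koszul (toric_seq int) 1 i k = toric_seq int x.
  rewrite mxE set0P Ax /kosz_coef (big_pred1 x) => [|y]; last first.
    by rewrite inE /=; case: (eqVneq y x) => //= ->; rewrite setDv eqxx.
  rewrite /kosz_sign (_ : [set c in _ | _] = set0) ?cards0 ?mul1r //.
  by apply/setP => y; rewrite !inE; case: (eqVneq y x) => //= ->; rewrite ltnn.
have [p [v [_ pv]]] := @transl_mxP _ _ T int (delta_mx 0 x) u.
exists (tagnat.Rank i0 p), (tagnat.Rank i0 u), v, 0 => i; rewrite mxE -/k -/u coef.
have -> : res_elt T (toric_seq int x) (tagnat.sig2 i) u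
   = mon int v *+ (tagnat.sig2 i == p) - mon int 0 *+ (tagnat.sig2 i == u).
  by rewrite res_eltB res_elt1 mxE [X in _ + X]mxE res_elt_mon pv mxE mon0.
have sE q : (i == tagnat.Rank i0 q) = (tagnat.sig2 i == q).
  rewrite -[i in LHS]tagnat.sig2K -val_eqE /= tagnat.eq_Rank.
  by rewrite (i0P (tagnat.sig1 i)) eqxx.
by rewrite !sE.
Qed.

Definition hypercubic : periodic_complex (sublattice L) :=
  PeriodicComplex hyper_bd0 hyper_bd_bd hyper_edge.

Lemma res_mx_gcoef (K : comNzRingType) m n (M : 'M[galg int 'rV[int]_D]_(m, n)) :
  res_mx T (map_mx (@gcoef K _) M) = map_mx (@gcoef K _) (res_mx T M).
Proof.
apply/matrixP => s t; rewrite !mxE.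
move: (M _ _) (tagnat.sig2 s) (tagnat.sig2 t) => a i k; move: a.
apply: galg_ext => [a b|a b|c v].
- by rewrite gcoefB res_eltB !mxE.
- by rewrite res_eltB !mxE gcoefB.
rewrite gcoefU !res_eltU !mxE rmorphM /= gcoefU; congr (_ * _).
case: insubP => [l _ _|_]; last by rewrite rmorph0.
by rewrite gcoef_mon.
Qed.

Lemma map_toric_seq (K : comNzRingType) i :
  map_mx (@gcoef K _) (koszul (toric_seq int) i) = koszul (toric_seq K) i.
Proof.
rewrite map_koszul; apply: eq_koszul => k.
by rewrite rmorphB rmorph1 /= gcoef_mon.
Qed.

Lemma hypercubic_X (K : comNzRingType) j :
  cs_X (cell_code K hypercubic j) = cs_X (res_code T (koszul_code (toric_seq K) j)).
Proof.
rewrite [LHS]/(dag (map_mx (@gcoef K _) (res_mx T (koszul (toric_seq int) j)))).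
rewrite -(res_mx_gcoef K (koszul (toric_seq int) j)) map_toric_seq.
by rewrite [RHS]res_mx_dag.
Qed.

Lemma hypercubic_Z (K : comNzRingType) j :
  cs_Z (cell_code K hypercubic j) = cs_Z (res_code T (koszul_code (toric_seq K) j)).
Proof.
have := res_mx_gcoef K (koszul (toric_seq int) j.+1).
by rewrite map_toric_seq => E; symmetry; exact: E.
Qed.

Definition toric_code_realization (K : comNzRingType) j
    (TC : css_code K (sublattice L)) :=
  exists2 C, expansion_collapse_equiv hypercubic C & TC = cell_code K C j.

End Hypercubic.

(* Main.v *)
(* Over the group algebra of Lambda, the restricted Koszul complex of f is a free
   resolution of S, and Q copies of the toric complex form a free resolution of
   K^Q (K = Z/p^m) with trivial translations.  If Lambda acts trivially on S, both
   resolve the same module; matrices with the same image, hence presentations of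
   isomorphic modules, hence (taking kernels) all higher differentials of two free
   resolutions, are equivalent up to identity and zero blocks.  Invertible matrices
   suffice for this, since W + W^-1 is a product of elementary matrices and W^-1
   can act on added zero rows.  Conversely, the Koszul complex is self-dual, so an
   equivalence in degree j descends through the dual complexes to degree 1.  There
   no nonzero linear functional on A^N kills the image of the first Koszul
   differential, so that S consists of classes on which every functional vanishes;
   such classes on the toric side are fixed by translations.  Elementary expansions
   only add identity and zero blocks to the boundary matrices, so the cellulation
   does not matter. *)
Require Import Defs.
From HB Require Import structures.
From mathcomp Require Import all_boot all_order all_algebra.
From mathcomp Require Import finmap monalg.
From Stdlib Require Import IndefiniteDescription.

Set Implicit Arguments.
Unset Strict Implicit.
Unset Printing Implicit Defensive.

Import GRing.Theory.
Local Open Scope ring_scope.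

(** * Stable equivalence of matrices *)

Section MatrixEquivalence.
Variable A : comNzRingType.

(** The sizes may differ a priori and both inverses are explicit, so that composition and direct
    sums need no casts. *)
Definition mxequiv m n m' n' (M : 'M[A]_(m, n)) (N : 'M[A]_(m', n')) :=
  exists (W : 'M[A]_(m', m)) (W' : 'M[A]_(m, m'))
         (F : 'M[A]_(n, n')) (F' : 'M[A]_(n', n)),
    [/\ W *m W' = 1%:M, W' *m W = 1%:M, F *m F' = 1%:M, F' *m F = 1%:M
      & W *m M *m F = N].

Definition dsum m n m' n' (M : 'M[A]_(m, n)) (N : 'M[A]_(m', n')) :
  'M[A]_(m + m', n + n') := block_mx M 0 0 N.

Definition trivmx a b e : 'M[A]_(a + b, a + e) :=
  dsum (1%:M : 'M_a) (0 : 'M_(b, e)).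

(** Row operations are arbitrary invertible matrices here; over a group algebra,
    [stable_clifford_equivP] identifies this relation with the one that uses elementary matrices. *)
Definition steq m n m' n' (M : 'M[A]_(m, n)) (N : 'M[A]_(m', n')) :=
  exists a b e a' b' e',
    mxequiv (dsum M (trivmx a b e)) (dsum N (trivmx a' b' e')).

Definition exact_pair m n l (P : 'M[A]_(m, n)) (Q : 'M[A]_(n, l)) :=
  forall x : 'cV_n, P *m x = 0 <-> exists y, x = Q *m y.

Lemma mxequiv_refl m n (M : 'M[A]_(m, n)) : mxequiv M M.
Proof. by exists 1%:M, 1%:M, 1%:M, 1%:M; rewrite !mulmx1 mul1mx. Qed.

Lemma mxequiv_sym m n m' n' (M : 'M[A]_(m, n)) (N : 'M[A]_(m', n')) :
  mxequiv M N -> mxequiv N M.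
Proof.
move=> [W [W' [F [F' [WW WW' FF FF' <-]]]]]; exists W', W, F', F; split=> //.
by rewrite !mulmxA WW' mul1mx -mulmxA FF mulmx1.
Qed.

Lemma mxequiv_trans m n m' n' m'' n'' (M : 'M[A]_(m, n)) (N : 'M[A]_(m', n'))
    (P : 'M[A]_(m'', n'')) : mxequiv M N -> mxequiv N P -> mxequiv M P.
Proof.
move=> [W [W' [F [F' [WW WW' FF FF' <-]]]]] [X [X' [G [G' [XX XX' GG GG' <-]]]]].
exists (X *m W), (W' *m X'), (F *m G), (G' *m F'); split.
- by rewrite mulmxA -(mulmxA X) WW mulmx1.
- by rewrite mulmxA -(mulmxA W') XX' mulmx1.
- by rewrite mulmxA -(mulmxA F) GG mulmx1.
- by rewrite mulmxA -(mulmxA G') FF' mulmx1.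
- by rewrite !mulmxA.
Qed.

Lemma mxequiv_mull m n m' (W : 'M[A]_(m', m)) W' (M : 'M[A]_(m, n)) :
  W *m W' = 1%:M -> W' *m W = 1%:M -> mxequiv M (W *m M).
Proof. by move=> H H'; exists W, W', 1%:M, 1%:M; rewrite !mulmx1. Qed.

Lemma mxequiv_cast m n m' n' (e : (m = m') * (n = n')) (M : 'M[A]_(m, n)) :
  mxequiv M (castmx e M).
Proof.
by case: e => em en; subst m' n'; rewrite castmx_id; apply: mxequiv_refl.
Qed.

Lemma mul_dsum m n l m' n' l' (M : 'M[A]_(m, n)) (N : 'M[A]_(n, l))
    (M' : 'M[A]_(m', n')) (N' : 'M[A]_(n', l')) :
  dsum M M' *m dsum N N' = dsum (M *m N) (M' *m N').
Proof. by rewrite mulmx_block !(mul0mx, mulmx0) !(addr0, add0r). Qed.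

Lemma dsum11 m n : dsum (1%:M : 'M[A]_m) (1%:M : 'M[A]_n) = 1%:M.
Proof. by rewrite /dsum -scalar_mx_block. Qed.

Lemma dsum00 m n m' n' : dsum (0 : 'M[A]_(m, n)) (0 : 'M[A]_(m', n')) = 0.
Proof. exact: block_mx0. Qed.

Lemma mxequiv_dsum m n m' n' p q p' q' (M : 'M[A]_(m, n)) (N : 'M[A]_(m', n'))
    (P : 'M[A]_(p, q)) (Q : 'M[A]_(p', q')) :
  mxequiv M N -> mxequiv P Q -> mxequiv (dsum M P) (dsum N Q).
Proof.
move=> [W [W' [F [F' [WW WW' FF FF' <-]]]]] [X [X' [G [G' [XX XX' GG GG' <-]]]]].
exists (dsum W X), (dsum W' X'), (dsum F G), (dsum F' G').
by rewrite !mul_dsum WW WW' FF FF' XX XX' GG GG' !dsum11.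
Qed.

Lemma mxequiv_dsumC m n m' n' (M : 'M[A]_(m, n)) (N : 'M[A]_(m', n')) :
  mxequiv (dsum M N) (dsum N M).
Proof.
exists (block_mx 0 1%:M 1%:M 0), (block_mx 0 1%:M 1%:M 0),
       (block_mx 0 1%:M 1%:M 0), (block_mx 0 1%:M 1%:M 0).
by rewrite /dsum !mulmx_block !(mul0mx, mulmx0, mul1mx, mulmx1) !(addr0, add0r)
  -!scalar_mx_block.
Qed.

Lemma mxequiv_dsumA m n m' n' m'' n'' (M : 'M[A]_(m, n)) (N : 'M[A]_(m', n'))
    (P : 'M[A]_(m'', n'')) :
  mxequiv (dsum M (dsum N P)) (dsum (dsum M N) P).
Proof.
have := @block_mxA A m m' m'' n n' n'' M 0 0 0 N 0 0 0 P.
rewrite /= !row_mx0 !col_mx0 => E; rewrite /dsum E.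
exact/mxequiv_sym/mxequiv_cast.
Qed.

End MatrixEquivalence.

Section StableEquivalence.
Variable A : comNzRingType.

Lemma mxequiv_dsumACA m n m' n' p q p' q' (M : 'M[A]_(m, n)) (N : 'M[A]_(m', n'))
    (P : 'M[A]_(p, q)) (Q : 'M[A]_(p', q')) :
  mxequiv (dsum (dsum M N) (dsum P Q)) (dsum (dsum M P) (dsum N Q)).
Proof.
apply: mxequiv_trans (mxequiv_sym (mxequiv_dsumA _ _ _)) _.
apply: mxequiv_trans (mxequiv_dsumA _ _ _).
apply: mxequiv_dsum (mxequiv_refl _) _.
apply: mxequiv_trans (mxequiv_dsumA _ _ _) _.
apply: mxequiv_trans (mxequiv_sym (mxequiv_dsumA _ _ _)).
exact: mxequiv_dsum (mxequiv_dsumC _ _) (mxequiv_refl _).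
Qed.

(** Unlike the literal form [trivmx], this property is closed under direct sums and covers identity
    and zero matrices of any size, so later proofs need not reorder blocks. *)
Definition istriv m n (T : 'M[A]_(m, n)) :=
  exists a b e, mxequiv T (trivmx A a b e).

Lemma istriv_dsum m n m' n' (T : 'M[A]_(m, n)) (T' : 'M[A]_(m', n')) :
  istriv T -> istriv T' -> istriv (dsum T T').
Proof.
move=> [a [b [e ET]]] [a' [b' [e' ET']]].
exists (a + a')%N, (b + b')%N, (e + e')%N.
apply: mxequiv_trans (mxequiv_dsum ET ET') _.
apply: mxequiv_trans (mxequiv_dsumACA _ _ _ _) _.
by rewrite dsum11 dsum00; apply: mxequiv_refl.
Qed.

Lemma istriv_1 n : istriv (1%:M : 'M[A]_n).
Proof.
exists n, 0, 0; apply: mxequiv_sym.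
apply: mxequiv_trans (mxequiv_dsumC _ _) _.
rewrite /dsum [X in block_mx X](_ : _ = 1%:M); last by apply/matrixP => -[].
by rewrite -scalar_mx_block; apply: mxequiv_refl.
Qed.

Lemma istriv_0 m n : istriv (0 : 'M[A]_(m, n)).
Proof.
exists 0, m, n; rewrite /trivmx [X in dsum X](_ : _ = 0); last by apply/matrixP => -[].
by rewrite dsum00; apply: mxequiv_refl.
Qed.

Lemma istriv_trivmx a b e : istriv (trivmx A a b e).
Proof. exact: istriv_dsum (istriv_1 _) (istriv_0 _ _). Qed.

Lemma steqI m n m' n' p q p' q' (M : 'M[A]_(m, n)) (N : 'M[A]_(m', n'))
    (T : 'M[A]_(p, q)) (T' : 'M[A]_(p', q')) :
  istriv T -> istriv T' -> mxequiv (dsum M T) (dsum N T') -> steq M N.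
Proof.
move=> [a [b [e ET]]] [a' [b' [e' ET']]] MN.
exists a, b, e, a', b', e'.
apply: mxequiv_trans (mxequiv_dsum (mxequiv_refl M) (mxequiv_sym ET)) _.
exact: mxequiv_trans MN (mxequiv_dsum (mxequiv_refl N) ET').
Qed.

Lemma mxequiv_steq m n m' n' (M : 'M[A]_(m, n)) (N : 'M[A]_(m', n')) :
  mxequiv M N -> steq M N.
Proof.
move=> MN; apply: (steqI (istriv_1 0) (istriv_1 0)).
exact: mxequiv_dsum MN (mxequiv_refl _).
Qed.

Lemma steq_refl m n (M : 'M[A]_(m, n)) : steq M M.
Proof. exact/mxequiv_steq/mxequiv_refl. Qed.

Lemma steq_sym m n m' n' (M : 'M[A]_(m, n)) (N : 'M[A]_(m', n')) :
  steq M N -> steq N M.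
Proof.
move=> [a [b [e [a' [b' [e' /mxequiv_sym MN]]]]]].
by exists a', b', e', a, b, e.
Qed.

(** Both stabilizations of [N] are made at once, and [mxequiv_dsumC] exchanges the two added
    blocks. *)
Lemma steq_trans m n m' n' m'' n'' (M : 'M[A]_(m, n)) (N : 'M[A]_(m', n'))
    (P : 'M[A]_(m'', n'')) : steq M N -> steq N P -> steq M P.
Proof.
move=> [a [b [e [a' [b' [e' MN]]]]]] [c [d [g [c' [d' [g' NP]]]]]].
apply: (steqI (istriv_dsum (istriv_trivmx a b e) (istriv_trivmx c d g))
  (istriv_dsum (istriv_trivmx c' d' g') (istriv_trivmx a' b' e'))).
apply: mxequiv_trans (mxequiv_dsumA _ _ _) _.
apply: mxequiv_trans (mxequiv_dsum MN (mxequiv_refl _)) _.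
apply: mxequiv_trans (mxequiv_sym (mxequiv_dsumA _ _ _)) _.
apply: mxequiv_trans (mxequiv_dsum (mxequiv_refl _) (mxequiv_dsumC _ _)) _.
apply: mxequiv_trans (mxequiv_dsumA _ _ _) _.
apply: mxequiv_trans (mxequiv_dsum NP (mxequiv_refl _)) _.
exact: mxequiv_sym (mxequiv_dsumA _ _ _).
Qed.

Lemma steq_dsumr m n p q (M : 'M[A]_(m, n)) (T : 'M[A]_(p, q)) :
  istriv T -> steq (dsum M T) M.
Proof.
move=> tT; apply: (steqI (istriv_1 0) (istriv_dsum tT (istriv_1 0))).
exact: mxequiv_sym (mxequiv_dsumA _ _ _).
Qed.

Lemma steq_dsuml m n p q (M : 'M[A]_(m, n)) (T : 'M[A]_(p, q)) :
  istriv T -> steq (dsum T M) M.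
Proof.
move=> tT; apply: steq_trans (steq_dsumr M tT).
exact/mxequiv_steq/mxequiv_dsumC.
Qed.

(* Conjugating by the involution [[1 - W W', W], [W', 0]] moves [W M] to [M]. *)
Lemma steq_mull m n m' (W : 'M[A]_(m', m)) W' (M : 'M[A]_(m, n)) :
  W' *m W = 1%:M -> steq (W *m M) M.
Proof.
move=> WW.
pose I := block_mx (1%:M - W *m W') W W' 0.
have II : I *m I = 1%:M.
  rewrite mulmx_block !mulmxBl !mulmxBr !mul1mx !mulmx1 !(mulmx0, mul0mx, addr0).
  rewrite !mulmxA -!(mulmxA W W') WW mulmx1 !mul1mx !subrr subr0 subrK.
  by rewrite -scalar_mx_block.
apply: (steqI (T := (0 : 'M_(m, 0))) (T' := (0 : 'M_(m', 0))));
  try exact: istriv_0.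
apply: mxequiv_sym; apply: mxequiv_trans (mxequiv_dsumC _ _) _.
exists I, I, (block_mx 0 1%:M 1%:M 0), (block_mx 0 1%:M 1%:M 0); split=> //.
- by rewrite mulmx_block !(mul0mx, mulmx0, mul1mx, mulmx1) !(addr0, add0r)
    -!scalar_mx_block.
- by rewrite mulmx_block !(mul0mx, mulmx0, mul1mx, mulmx1) !(addr0, add0r)
    -!scalar_mx_block.
by rewrite !mulmx_block !(mulmx0, mul0mx, addr0, add0r, mulmx1).
Qed.

(** Column version of [steq_mull], with the involution [[1 - V' V, V'], [V, 0]]. *)
Lemma steq_mulr m n n' (V : 'M[A]_(n, n')) V' (M : 'M[A]_(m, n)) :
  V *m V' = 1%:M -> steq (M *m V) M.
Proof.
move=> VV.
pose I := block_mx (1%:M - V' *m V) V' V 0.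
have II : I *m I = 1%:M.
  rewrite mulmx_block !mulmxBl !mulmxBr !mul1mx !mulmx1 !(mulmx0, mul0mx, addr0).
  rewrite !mulmxA -!(mulmxA V' V) VV mulmx1 !mul1mx !subrr subr0 subrK.
  by rewrite -scalar_mx_block.
apply: (steqI (T := (0 : 'M_(0, n))) (T' := (0 : 'M_(0, n'))));
  try exact: istriv_0.
apply: mxequiv_sym; apply: mxequiv_trans (mxequiv_dsumC _ _) _.
exists (block_mx 0 1%:M 1%:M 0), (block_mx 0 1%:M 1%:M 0), I, I; split=> //.
- by rewrite mulmx_block !(mul0mx, mulmx0, mul1mx, mulmx1) !(addr0, add0r)
    -!scalar_mx_block.
- by rewrite mulmx_block !(mul0mx, mulmx0, mul1mx, mulmx1) !(addr0, add0r)
    -!scalar_mx_block.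
by rewrite !mulmx_block !(mulmx0, mul0mx, addr0, add0r, mul1mx).
Qed.

Lemma mulmx_cols m n l (P : 'M[A]_(m, n)) (X : 'M[A]_(m, l)) :
  (forall k, exists y : 'cV_n, col k X = P *m y) -> exists Y, X = P *m Y.
Proof.
move=> /fin_all_exists[y Hy]; exists (\matrix_(i, k) y k i 0).
apply/matrixP => i k; have /colP/(_ i) := Hy k; rewrite !mxE => ->.
by apply: eq_bigr => l' _; rewrite !mxE.
Qed.

(** Each matrix factors through the other, and both are compared with [row_mx P P']: if
    [P' = P *m X], this is [P *m row_mx 1%:M X], whose second factor has a right inverse. *)
Lemma steq_same_image m n n' (P : 'M[A]_(m, n)) (P' : 'M[A]_(m, n')) :
  (forall y : 'cV_n, exists y', P *m y = P' *m y') ->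
  (forall y' : 'cV_n', exists y, P' *m y' = P *m y) -> steq P P'.
Proof.
move=> H H'.
have [X EX] : exists X, P' = P *m X.
  by apply: mulmx_cols => k; rewrite colE.
have [Y EY] : exists Y, P = P' *m Y.
  by apply: mulmx_cols => k; rewrite colE.
have one_sided p q (M : 'M[A]_(m, p)) (N : 'M[A]_(m, q)) Z : N = M *m Z ->
    steq M (row_mx M N).
  move=> ->.
  have -> : row_mx M (M *m Z) = M *m row_mx 1%:M Z.
    by rewrite mul_mx_row mulmx1.
  apply: steq_sym; apply: (@steq_mulr _ _ _ _ (col_mx 1%:M 0)).
  by rewrite mul_row_col mulmx1 mulmx0 addr0.
apply: steq_trans (one_sided _ _ _ _ _ EX) _.
apply: steq_trans (steq_sym (one_sided _ _ _ _ _ EY)).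
have -> : row_mx P' P = row_mx P P' *m block_mx 0 1%:M 1%:M 0.
  by rewrite mul_row_block !(mulmx0, mulmx1, addr0, add0r).
apply/steq_sym/(@steq_mulr _ _ _ _ (block_mx 0 1%:M 1%:M 0)).
by rewrite mulmx_block !(mul0mx, mulmx0, mul1mx, mulmx1) !(addr0, add0r)
    -!scalar_mx_block.
Qed.

Lemma exact_dsum m n l m' n' l' (P : 'M[A]_(m, n)) (Q : 'M[A]_(n, l))
    (P' : 'M[A]_(m', n')) (Q' : 'M[A]_(n', l')) :
  exact_pair P Q -> exact_pair P' Q' -> exact_pair (dsum P P') (dsum Q Q').
Proof.
move=> E E' x; rewrite -[x]vsubmxK /dsum mul_block_col !mul0mx addr0 add0r.
split=> [/eqP|[y]].
  rewrite col_mx_eq0 => /andP[/eqP/E[y ->] /eqP/E'[y' ->]].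
  by exists (col_mx y y'); rewrite mul_block_col !mul0mx addr0 add0r.
rewrite -[y]vsubmxK mul_block_col !mul0mx addr0 add0r => /eq_col_mx[x1 x2].
suff -> : P *m usubmx x = 0 by rewrite (_ : P' *m _ = 0) ?col_mx0 //; apply/E'; exists (dsubmx y).
by apply/E; exists (usubmx y).
Qed.

Lemma exact_1 n : exact_pair (1%:M : 'M[A]_n) (0 : 'M_(n, 0)).
Proof.
move=> x; rewrite mul1mx; split=> [->|[y ->]]; last by rewrite mul0mx.
by exists 0; rewrite mulmx0.
Qed.

Lemma exact_0 m n : exact_pair (0 : 'M[A]_(m, n)) (1%:M : 'M_n).
Proof.
move=> x; rewrite mul0mx; split=> // _.
by exists x; rewrite mul1mx.
Qed.

(** The column isomorphism [F'] carries the kernel of [P] onto that of [P'], so [F' *m Q] and [Q']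
    have the same image. *)
Lemma mxequiv_kernel m n l m' n' l' (P : 'M[A]_(m, n)) (Q : 'M[A]_(n, l))
    (P' : 'M[A]_(m', n')) (Q' : 'M[A]_(n', l')) :
  exact_pair P Q -> exact_pair P' Q' -> mxequiv P P' -> steq Q Q'.
Proof.
move=> E E' [W [W' [F [F' [WW WW' FF FF' PP]]]]].
apply: steq_trans (steq_sym (steq_mull Q FF)) _.
have H x : P *m x = 0 <-> P' *m (F' *m x) = 0.
  rewrite -PP -mulmxA [F *m _]mulmxA FF mul1mx -mulmxA.
  split=> [->|E0]; first by rewrite mulmx0.
  by rewrite -[P *m x]mul1mx -WW' -mulmxA E0 mulmx0.
apply: steq_same_image => y.
  by rewrite -mulmxA; apply/E'/H/E; exists y.
have : exists z, F *m (Q' *m y) = Q *m z.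
  apply/E/H; rewrite [F' *m _]mulmxA FF' mul1mx.
  by apply/E'; exists y.
by case=> z Hz; exists z; rewrite -mulmxA -Hz mulmxA FF' mul1mx.
Qed.

(** The step along a resolution. Stabilizing [P] adds nothing to its kernel for the identity block
    and a free summand for the zero columns, so [Q] only gains a trivial block. *)
Lemma steq_kernel m n l m' n' l' (P : 'M[A]_(m, n)) (Q : 'M[A]_(n, l))
    (P' : 'M[A]_(m', n')) (Q' : 'M[A]_(n', l')) :
  exact_pair P Q -> exact_pair P' Q' -> steq P P' -> steq Q Q'.
Proof.
move=> E E' [a [b [e [a' [b' [e' PP]]]]]].
have ker_triv p q c d g (M : 'M[A]_(p, q)) r (N : 'M_(q, r)) : exact_pair M N ->
    exact_pair (dsum M (trivmx A c d g)) (dsum N (dsum (0 : 'M_(c, 0)) (1%:M : 'M_g))).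
  by move=> EMN; apply/exact_dsum/exact_dsum => //; [apply: exact_1 | apply: exact_0].
have QQ := mxequiv_kernel (ker_triv _ _ a b e _ _ _ E) (ker_triv _ _ a' b' e' _ _ _ E') PP.
have st p q M c g : @steq A _ _ _ _ (dsum M (dsum (0 : 'M_(c, 0)) (1%:M : 'M_g))) (M : 'M_(p, q)).
  exact: steq_dsumr (istriv_dsum (istriv_0 _ _) (istriv_1 _)).
exact: steq_trans (steq_sym (st _ _ _ _ _)) (steq_trans QQ (st _ _ _ _ _)).
Qed.

(* Both block matrices below have as image the kernel of
   [(x, y) |-> rho x + rho' y], so they present the same module. *)
Lemma steq_presentation (S : zmodType) m n m' n'
    (P : 'M[A]_(m, n)) (P' : 'M[A]_(m', n'))
    (rho : 'cV[A]_m -> S) (rho' : 'cV[A]_m' -> S) (V : 'M_(m, m')) (U : 'M_(m', m)) :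
  {morph rho : x y / x - y} -> {morph rho' : x y / x - y} ->
  (forall x, rho x = 0 <-> exists y, x = P *m y) ->
  (forall x, rho' x = 0 <-> exists y, x = P' *m y) ->
  (forall x, rho (V *m x) = rho' x) -> (forall x, rho' (U *m x) = rho x) ->
  steq P P'.
Proof.
move=> rB rB' K K' HV HU.
pose B := block_mx P (- V) 0 1%:M; pose B' := block_mx 1%:M 0 (- U) P'.
have imB x x' : rho x + rho' x' = 0 <-> exists y, col_mx x x' = B *m y.
  split=> [E|[y]].
    have /K[y Hy] : rho (x + V *m x') = 0 by rewrite (morphBD rB) HV.
    exists (col_mx y x'); rewrite mul_block_col mul0mx mul1mx add0r -Hy mulNmx.
    by rewrite addrK.
  rewrite -[y]vsubmxK mul_block_col mul0mx mul1mx add0r mulNmx => /eq_col_mx[-> ->].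
  rewrite rB HV subrK; apply/K; by exists (usubmx y).
have imB' x x' : rho x + rho' x' = 0 <-> exists y, col_mx x x' = B' *m y.
  split=> [E|[y]].
    have /K'[y Hy] : rho' (x' + U *m x) = 0 by rewrite (morphBD rB') HU addrC.
    exists (col_mx x y); rewrite mul_block_col mul0mx mul1mx addr0 -Hy mulNmx.
    by rewrite addrC addrK.
  rewrite -[y]vsubmxK mul_block_col mul0mx mul1mx addr0 mulNmx => /eq_col_mx[-> ->].
  rewrite addrC (addrC (- _)) rB' HU subrK; apply/K'; by exists (dsubmx y).
have BB : steq B B'.
  apply: steq_same_image => y; rewrite -[_ *m y]vsubmxK; [apply/imB'/imB | apply/imB/imB'];
    by exists y; rewrite vsubmxK.
have BP : steq B P.
  apply: steq_trans (steq_dsumr P (istriv_1 m')).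
  have -> : dsum P (1%:M : 'M_m') = block_mx 1%:M V 0 1%:M *m B.
    by rewrite mulmx_block !(mul1mx, mul0mx, mulmx1, mulmx0, addr0, add0r) addNr.
  apply/mxequiv_steq/(@mxequiv_mull _ _ _ _ _ (block_mx 1%:M (-V) 0 1%:M));
    by rewrite mulmx_block !(mul1mx, mul0mx, mulmx1, mulmx0, addr0, add0r) ?addNr ?subrr
      -scalar_mx_block.
have BP' : steq B' P'.
  apply: steq_trans (steq_dsuml P' (istriv_1 m)).
  have -> : dsum (1%:M : 'M_m) P' = block_mx 1%:M 0 U 1%:M *m B'.
    by rewrite mulmx_block !(mul1mx, mul0mx, mulmx1, mulmx0, addr0, add0r) subrr.
  apply/mxequiv_steq/(@mxequiv_mull _ _ _ _ _ (block_mx 1%:M 0 (- U) 1%:M));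
    by rewrite mulmx_block !(mul1mx, mul0mx, mulmx1, mulmx0, addr0, add0r) ?addNr ?subrr
      -scalar_mx_block.
exact: steq_trans (steq_sym BP) (steq_trans BB BP').
Qed.

(* The functional [lam] splits the column [w] off the image of [N], so [N] is [M]
   together with one identity entry. *)
Lemma steq_split_col m n n' (M : 'M[A]_(m, n)) (N : 'M[A]_(m, n')) (w : 'cV_m)
    (lam : 'rV_m) : lam *m M = 0 -> lam *m w = 1%:M ->
  (forall y : 'cV_n', exists x t, N *m y = M *m x + t *: w) ->
  (forall (x : 'cV_n) t, exists y, M *m x + t *: w = N *m y) -> steq M N.
Proof.
move=> lM lw NM MN.
have [I II IN] : exists2 I : 'M[A]_(m + 1), I *m I = 1%:M &
    forall (x : 'cV_n) t, I *m col_mx (M *m x + t *: w) 0 = col_mx (M *m x) t%:M.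
  exists (block_mx (1%:M - w *m lam) w lam 0) => [|x t].
    rewrite mulmx_block !mulmxBl !mulmxBr !mul1mx !mulmx1 !(mulmx0, mul0mx, addr0).
    rewrite !mulmxA -!(mulmxA w lam) lw mulmx1 !mul1mx !subrr subr0 subrK.
    by rewrite -scalar_mx_block.
  rewrite mul_block_col mulmx0 mul0mx !addr0 mulmxBl mul1mx -mulmxA.
  rewrite mulmxDr mulmxA lM mul0mx add0r -!scalemxAr lw -scalemx1 -scalemxAr mulmx1.
  by rewrite !scale1r addrK scalemx1.
apply: steq_trans (steq_sym (steq_dsumr M (istriv_1 1))) _.
apply: steq_trans (steq_dsumr N (istriv_0 1 0)).
apply: steq_trans (steq_mull _ II).
apply: steq_same_image => y; rewrite -[y]vsubmxK.
  have [x Nx] := MN (usubmx y) (dsubmx y 0 0).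
  exists (col_mx x 0); rewrite -mulmxA.
  by rewrite !mul_block_col !mul0mx !addr0 -Nx IN mul1mx add0r -mx11_scalar.
have [x [t Nx]] := NM (usubmx y).
exists (col_mx x t%:M); rewrite -mulmxA.
by rewrite !mul_block_col !mul0mx !addr0 Nx IN mul1mx add0r.
Qed.

End StableEquivalence.

Lemma map_dsum (A B : comNzRingType) (h : {rmorphism A -> B}) m n m' n'
    (M : 'M[A]_(m, n)) (N : 'M[A]_(m', n')) :
  map_mx h (dsum M N) = dsum (map_mx h M) (map_mx h N).
Proof. by rewrite /dsum map_block_mx !map_mx0. Qed.

Lemma steq_map (A B : comNzRingType) (h : {rmorphism A -> B}) m n m' n'
    (M : 'M[A]_(m, n)) (N : 'M[A]_(m', n')) :
  steq M N -> steq (map_mx h M) (map_mx h N).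
Proof.
move=> [a [b [e [a' [b' [e' [W [W' [F [F' [WW WW' FF FF' E]]]]]]]]]]].
exists a, b, e, a', b', e'.
exists (map_mx h W), (map_mx h W'), (map_mx h F), (map_mx h F').
rewrite -!map_mxM WW WW' FF FF' !map_mx1; split=> //.
have := congr1 (map_mx h) E.
by rewrite !map_mxM !map_dsum !map_mx0 !map_mx1.
Qed.

Lemma steq_tr (A : comNzRingType) m n m' n' (M : 'M[A]_(m, n)) (N : 'M[A]_(m', n')) :
  steq M N -> steq M^T N^T.
Proof.
move=> [a [b [e [a' [b' [e' [W [W' [F [F' [WW WW' FF FF' E]]]]]]]]]]].
exists a, e, b, a', e', b'.
exists F^T, F'^T, W^T, W'^T.
rewrite -!trmx_mul WW WW' FF FF' !trmx1; split=> //.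
have := congr1 trmx E; rewrite !trmx_mul mulmxA.
by rewrite /trivmx /dsum !tr_block_mx !trmx1 !trmx0.
Qed.

(** * Classes on which all linear functionals vanish *)

Section AnnihilatedTorsion.
Variable A : comNzRingType.

(* The condition on [x] says that every linear functional on the module presented
   by [M] vanishes at its class. *)
Definition kills_torsion m n r (M : 'M[A]_(m, n)) :=
  forall x : 'cV_m, (forall c : 'rV_m, c *m M = 0 -> c *m x = 0) ->
  exists y, r *: x = M *m y.

Lemma kills_torsion_mxequiv m n m' n' r (M : 'M[A]_(m, n)) (N : 'M[A]_(m', n')) :
  mxequiv M N -> kills_torsion r M -> kills_torsion r N.
Proof.
move=> [W [W' [F [F' [WW WW' FF FF' <-]]]]] kM x Hx.
have [c cM|y Hy] := kM (W' *m x).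
  rewrite mulmxA; apply: Hx.
  by rewrite !mulmxA -(mulmxA c) WW' mulmx1 cM mul0mx.
exists (F' *m y).
by rewrite -!mulmxA [F *m _]mulmxA FF mul1mx -Hy -scalemxAr mulmxA WW mul1mx.
Qed.

(** An identity block presents the zero module, and a zero block a free module, where the coordinate
    functionals detect every nonzero class; neither affects the condition. *)
Lemma kills_torsion_triv m n r a b e (M : 'M[A]_(m, n)) :
  kills_torsion r (dsum M (trivmx A a b e)) <-> kills_torsion r M.
Proof.
split=> kM x Hx.
  have [c|y] := kM (col_mx x 0).
    rewrite -[c]hsubmxK mul_row_block !mulmx0 addr0 => /(congr1 lsubmx).
    by rewrite row_mxKl linear0 => cM; rewrite mul_row_col mulmx0 addr0 Hx.
  rewrite -[y]vsubmxK mul_block_col scale_col_mx mul0mx addr0 => /eq_col_mx[E _].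
  by exists (usubmx y).
move: Hx; rewrite -[x]vsubmxK; set x1 := usubmx x; rewrite -[dsubmx x]vsubmxK.
set x2 := usubmx _; set x3 := dsubmx _ => Hx.
have x30 : x3 = 0.
  apply/colP => i; have := Hx (row_mx 0 (row_mx 0 (delta_mx 0 i))).
  rewrite !mul_row_block !(mulmx0, mul0mx, addr0, row_mx0) => /(_ erefl).
  rewrite !mul_row_col !mul0mx !add0r -rowE => /rowP/(_ 0).
  by rewrite !mxE.
have [c cM|y Hy] := kM x1.
  have := Hx (row_mx c 0); rewrite mul_row_block mul_row_col.
  by rewrite !(mulmx0, mul0mx, addr0) cM row_mx0; apply.
exists (col_mx y (col_mx (r *: x2) 0)).
by rewrite x30 !mul_block_col !(mulmx0, mul0mx, mul1mx, addr0, add0r)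
  !scale_col_mx Hy scaler0.
Qed.

Lemma kills_torsion_steq m n m' n' r (M : 'M[A]_(m, n)) (N : 'M[A]_(m', n')) :
  steq M N -> kills_torsion r N -> kills_torsion r M.
Proof.
move=> [a [b [e [a' [b' [e' /mxequiv_sym MN]]]]]] kN.
apply/(kills_torsion_triv r a b e)/(kills_torsion_mxequiv MN).
exact/kills_torsion_triv.
Qed.

End AnnihilatedTorsion.

(** * Elementary matrices and Whitehead's lemma *)

Lemma transvectionK (A : comNzRingType) q (r : A) (i k : 'I_q) : i != k ->
  (1%:M + r *: delta_mx i k) *m (1%:M - r *: delta_mx i k) = 1%:M /\
  (1%:M - r *: delta_mx i k) *m (1%:M + r *: delta_mx i k) = 1%:M.
Proof.
move=> ik; have dd : delta_mx i k *m delta_mx i k = 0 :> 'M[A]_q.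
  by rewrite mul_delta_mx_cond eq_sym (negPf ik) mulr0n.
split; [rewrite mulmxDl !mulmxBr | rewrite mulmxBl !mulmxDr];
  rewrite !mulmx1 !mul1mx -scalemxAr -scalemxAl dd !scaler0.
  by rewrite subr0 subrK.
by rewrite addr0 addrK.
Qed.

Lemma ublock_delta (A : comNzRingType) n m (b : A) (i : 'I_n) (k : 'I_m) :
  block_mx 1%:M (b *: delta_mx i k) 0 1%:M =
  1%:M + b *: delta_mx (lshift m i) (rshift n k).
Proof.
rewrite delta_mx_ushift delta_mx_rshift -[X in col_mx _ X]row_mx0.
rewrite -block_mxEv scale_block_mx !scaler0 scalar_mx_block add_block_mx.
by rewrite !addr0 add0r.
Qed.

Lemma lblock_delta (A : comNzRingType) n m (b : A) (i : 'I_m) (k : 'I_n) :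
  block_mx 1%:M 0 (b *: delta_mx i k) 1%:M =
  1%:M + b *: delta_mx (rshift n i) (lshift m k).
Proof.
rewrite delta_mx_dshift delta_mx_lshift -[X in col_mx X _]row_mx0.
rewrite -block_mxEv scale_block_mx !scaler0 scalar_mx_block add_block_mx.
by rewrite !addr0 add0r.
Qed.

Lemma whitehead_rotation (A : comNzRingType) n (B C : 'M[A]_n) :
  B *m C = 1%:M -> C *m B = 1%:M ->
  block_mx 1%:M B 0 1%:M *m block_mx 1%:M 0 (- C) 1%:M *m block_mx 1%:M B 0 1%:M =
  block_mx 0 B (- C) 0.
Proof.
move=> BC CB; rewrite !mulmx_block !(mulmx0, mul0mx, mulmx1, mul1mx, addr0, add0r).
by rewrite mulmxN mulNmx BC CB subrr addNr mul0mx add0r.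
Qed.

(** The second factor is the rotation of [whitehead_rotation] for the pair -1, -1. Hence the
    diagonal block matrix is a product of unitriangular ones when [C] is the inverse of [B]. *)
Lemma whitehead_square (A : comNzRingType) n (B C : 'M[A]_n) :
  block_mx 0 B (- C) 0 *m block_mx 0 (- 1%:M) (- - 1%:M) 0 = block_mx B 0 0 C.
Proof.
rewrite mulmx_block !(mulmx0, mul0mx, addr0, add0r) opprK mulmx1.
by rewrite mulmxN mulmx1 opprK.
Qed.

Section Clifford.
Variables (K : comNzRingType) (G : zmodType).
Local Notation A := (galg K G).

Lemma elementary_mul q (M N : 'M[A]_q) :
  elementary M -> elementary N -> elementary (M *m N).
Proof.
move=> eM eN; elim: eM => [|r i k P ik _ IH]; first by rewrite mul1mx.
by rewrite -mulmxA; apply: ElementaryM.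
Qed.

Lemma elementary_inv q (M : 'M[A]_q) :
  elementary M -> exists M', M *m M' = 1%:M /\ M' *m M = 1%:M.
Proof.
elim=> [|r i k P ik _ [P' [PP PP']]]; first by exists 1%:M; rewrite !mulmx1.
exists (P' *m (1%:M - r *: delta_mx i k)); split.
  by rewrite mulmxA -(mulmxA _ P) PP mulmx1; apply: (transvectionK r ik).1.
by rewrite mulmxA -(mulmxA P') (transvectionK r ik).2 mulmx1.
Qed.

(** Products of such matrices add their off-diagonal blocks, which reduces the claim to a block with
    one nonzero entry, that is, to a generator. *)
Lemma elementary_ublock n m (B : 'M[A]_(n, m)) :
  elementary (block_mx 1%:M B 0 1%:M).
Proof.
have P0 : elementary (block_mx 1%:M (0 : 'M[A]_(n, m)) 0 1%:M).
  by rewrite -scalar_mx_block; constructor.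
have PD (M N : 'M[A]_(n, m)) : elementary (block_mx 1%:M M 0 1%:M) ->
    elementary (block_mx 1%:M N 0 1%:M) ->
    elementary (block_mx 1%:M (M + N) 0 1%:M).
  move=> eM eN; have := elementary_mul eN eM.
  by rewrite mulmx_block !(mulmx0, mul0mx, mulmx1, mul1mx, addr0, add0r).
rewrite [B]matrix_sum_delta.
apply: (big_ind (fun N : 'M_(n, m) => elementary (block_mx 1%:M N 0 1%:M))) => // i _.
apply: (big_ind (fun N : 'M_(n, m) => elementary (block_mx 1%:M N 0 1%:M))) => // k _.
rewrite ublock_delta -[_ + _]mulmx1.
by apply: ElementaryM; [rewrite eq_lrshift | constructor].
Qed.

Lemma elementary_lblock n m (B : 'M[A]_(m, n)) :
  elementary (block_mx 1%:M 0 B 1%:M).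
Proof.
have P0 : elementary (block_mx 1%:M 0 (0 : 'M[A]_(m, n)) 1%:M).
  by rewrite -scalar_mx_block; constructor.
have PD (M N : 'M[A]_(m, n)) : elementary (block_mx 1%:M 0 M 1%:M) ->
    elementary (block_mx 1%:M 0 N 1%:M) ->
    elementary (block_mx 1%:M 0 (M + N) 1%:M).
  move=> eM eN; have := elementary_mul eM eN.
  by rewrite mulmx_block !(mulmx0, mul0mx, mulmx1, mul1mx, addr0, add0r).
rewrite [B]matrix_sum_delta.
apply: (big_ind (fun N : 'M_(m, n) => elementary (block_mx 1%:M 0 N 1%:M))) => // i _.
apply: (big_ind (fun N : 'M_(m, n) => elementary (block_mx 1%:M 0 N 1%:M))) => // k _.
rewrite lblock_delta -[_ + _]mulmx1.
by apply: ElementaryM; [rewrite eq_rlshift | constructor].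
Qed.

Lemma elementary_whitehead n (W W' : 'M[A]_n) :
  W *m W' = 1%:M -> W' *m W = 1%:M -> elementary (block_mx W 0 0 W').
Proof.
move=> WW WW'.
have rot (B C : 'M[A]_n) : B *m C = 1%:M -> C *m B = 1%:M ->
    elementary (block_mx 0 B (- C) 0).
  move=> BC CB; rewrite -(whitehead_rotation BC CB).
  apply: elementary_mul (elementary_ublock B).
  exact: elementary_mul (elementary_ublock B) (elementary_lblock (- C)).
have := elementary_mul (rot _ _ WW WW') (rot (- 1%:M) (- 1%:M) _ _).
by rewrite whitehead_square mulmxN mulNmx mulmx1 opprK; apply.
Qed.

Lemma clifford_equiv_cast q a q' a' (e : q = q') (e' : a = a') (M N : 'M[A]_(q, a)) :
  clifford_equiv M N -> clifford_equiv (castmx (e, e') M) (castmx (e, e') N).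
Proof. by subst q' a'; rewrite !castmx_id. Qed.

(** The added zero rows leave room for the inverse of [W], and [W] together with its inverse on the
    diagonal is elementary. The sizes agree by [mulmx1_min]. *)
Lemma mxequiv_clifford n c n' c' (X : 'M[A]_(n, c)) (Y : 'M[A]_(n', c')) :
  mxequiv X Y -> exists (e : (n + n = n' + n)%N) (e' : c = c'),
    clifford_equiv (castmx (e, e') (col_mx X (0 : 'M_(n, c))))
                   (col_mx Y (0 : 'M_(n, c'))).
Proof.
move=> [W [W' [F [F' [WW WW' FF FF' <-]]]]].
have e : n = n' by apply/anti_leq; rewrite (mulmx1_min WW) (mulmx1_min WW').
have e' : c = c' by apply/anti_leq; rewrite (mulmx1_min FF) (mulmx1_min FF').
subst n' c'; exists erefl, erefl; rewrite castmx_id.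
exists (block_mx W 0 0 W'), F; split; first exact: elementary_whitehead.
  by exists F'.
by rewrite mul_block_col !(mulmx0, mul0mx, addr0) mul_col_mx mul0mx.
Qed.

Lemma stabilize_rows q a (M : 'M[A]_(q, a)) al be et n
    (e : (q + al + be + n = q + al + (be + n))%N) :
  stabilize M al (be + n) et =
  castmx (e, erefl) (col_mx (stabilize M al be et) (0 : 'M_(n, _))).
Proof.
rewrite /stabilize !block_mxEv row_mx0.
have := @col_mxA _ (q + al) be n _ (row_mx (block_mx M 0 0 1%:M) 0)
   (0 : 'M_(be, a + al + et)) 0.
rewrite col_mx0 => ->; rewrite -row_mx0; congr castmx.
by congr pair; apply: eq_irrelevance.
Qed.

Lemma stable_clifford_equivP q a q' a' (M : 'M[A]_(q, a)) (M' : 'M[A]_(q', a')) :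
  stable_clifford_equiv M M' <-> steq M M'.
Proof.
split=> [[al [be [et [al' [be' [et' [eq_q [eq_a [W [F [eW [F' [FF FF']] E]]]]]]]]]]]|].
  apply: (steqI (istriv_trivmx _ al be et) (istriv_trivmx _ al' be' et')).
  apply: mxequiv_trans (mxequiv_dsumA _ _ _) _.
  apply: mxequiv_trans (mxequiv_sym (mxequiv_dsumA _ _ _)).
  rewrite -[dsum (dsum M' _) _]/(stabilize M' al' be' et') -E.
  have [W' [WW WW']] := elementary_inv eW.
  apply: mxequiv_trans (mxequiv_cast (eq_q, eq_a) _) _.
  by exists W, W', F, F'.
move=> [al [be [et [al' [be' [et' MM]]]]]].
have /mxequiv_clifford[e [e' C]] :
    mxequiv (stabilize M al be et) (stabilize M' al' be' et').
  apply: mxequiv_trans (mxequiv_sym (mxequiv_dsumA _ _ _)) _.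
  exact: mxequiv_trans MM (mxequiv_dsumA _ _ _).
(* [n] is the row count of the stabilized [M]; that many further zero rows are absorbed into the
   zero blocks on both sides. *)
set n := (q + al + be)%N in e C.
exists al, (be + n)%N, et, al', (be' + n)%N, et'.
have e1 : (q + al + be + n = q + al + (be + n))%N by rewrite !addnA.
have e2 : (q' + al' + be' + n = q' + al' + (be' + n))%N by rewrite !addnA.
have e3 : (q + al + (be + n) = q' + al' + (be' + n))%N by rewrite -e1 e.
exists e3, e'; rewrite (stabilize_rows M et e1) (stabilize_rows M' et' e2).
have := clifford_equiv_cast e2 (erefl _) C; rewrite !castmx_comp.
congr clifford_equiv; congr castmx.
by congr pair; apply: eq_irrelevance.
Qed.

Lemma steq_dag m n m' n' (M : 'M[A]_(m, n)) (N : 'M[A]_(m', n')) :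
  steq M N -> steq (dag M) (dag N).
Proof. by move=> MN; apply/steq_tr/(steq_map (@gbar K G)). Qed.

Lemma diag_copiesM Q m n l (M : 'M[A]_(m, n)) (N : 'M[A]_(n, l)) :
  diag_copies Q (M *m N) = diag_copies Q M *m diag_copies Q N.
Proof.
rewrite /diag_copies mul_mxblock; apply: eq_mxblock => i k.
rewrite (bigD1 i) //= eqxx big1 ?addr0; last first.
  by move=> l' /negPf nl; rewrite eq_sym nl mul0mx.
by case: eqP => _; rewrite ?mulmx0.
Qed.

Lemma diag_copiesD Q m n (M N : 'M[A]_(m, n)) :
  diag_copies Q (M + N) = diag_copies Q M + diag_copies Q N.
Proof.
rewrite /diag_copies -mxblockD; apply: eq_mxblock => i k.
by case: eqP => _; rewrite ?addr0.
Qed.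

Lemma diag_copies0 Q m n : diag_copies Q (0 : 'M[A]_(m, n)) = 0.
Proof.
rewrite /diag_copies -[RHS]mxblock0; apply: eq_mxblock => i k.
by case: eqP.
Qed.

Lemma diag_copies1 Q n : diag_copies Q (1%:M : 'M[A]_n) = 1%:M.
Proof.
rewrite -[RHS]mxdiagZ; apply: eq_mxblock => i k.
by rewrite /=; case: eqP => // ik; subst k; rewrite conform_mx_id.
Qed.

Lemma dag_diag_copies Q m n (M : 'M[A]_(m, n)) :
  dag (diag_copies Q M) = diag_copies Q (dag M).
Proof.
apply/matrixP => s t; rewrite !mxE eq_sym.
by case: ifP => _; rewrite !mxE ?rmorph0.
Qed.

Lemma mxequiv_diag_copies Q m n m' n' (M : 'M[A]_(m, n)) (N : 'M[A]_(m', n')) :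
  mxequiv M N -> mxequiv (diag_copies Q M) (diag_copies Q N).
Proof.
move=> [W [W' [F [F' [WW WW' FF FF' <-]]]]].
exists (diag_copies Q W), (diag_copies Q W'), (diag_copies Q F), (diag_copies Q F').
by rewrite -!diag_copiesM WW WW' FF FF' !diag_copies1.
Qed.

Lemma diag_copies_dsum Q m n m' n' (M : 'M[A]_(m, n)) (N : 'M[A]_(m', n')) :
  mxequiv (diag_copies Q (dsum M N)) (dsum (diag_copies Q M) (diag_copies Q N)).
Proof.
(* The inclusions and projections of the two summands, copied [Q] times, give the base change that
   regroups the copies. *)
have biprod p q : let D x y := @diag_copies K G Q x y in
    let W := row_mx (D (p + q)%N p (col_mx 1%:M 0)) (D (p + q)%N q (col_mx 0 1%:M)) in
    let W' := col_mx (D p (p + q)%N (row_mx 1%:M 0)) (D q (p + q)%N (row_mx 0 1%:M)) in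
    W *m W' = 1%:M /\ W' *m W = 1%:M.
  rewrite /= mul_row_col mul_col_row -!diag_copiesM -diag_copiesD.
  rewrite !mul_row_col !mul_col_row !(mulmx0, mul0mx, mulmx1, addr0, add0r).
  by rewrite add_block_mx !(addr0, add0r) -scalar_mx_block !diag_copies0
    !diag_copies1 -scalar_mx_block.
have [WW WW'] := biprod m m'; have [FF FF'] := biprod n n'.
apply: mxequiv_sym; do 4!eexists; split; [exact: WW|exact: WW'|exact: FF'|exact: FF|].
rewrite mul_row_block !mulmx0 addr0 add0r mul_row_col -!diag_copiesM -diag_copiesD.
rewrite (mul_col_mx _ _ M) (mul_col_mx _ _ N) !mul_col_row add_block_mx.
by rewrite !(mul0mx, mulmx0, mulmx1, mul1mx, addr0, add0r).
Qed.

Lemma steq_diag_copies Q m n m' n' (M : 'M[A]_(m, n)) (N : 'M[A]_(m', n')) :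
  steq M N -> steq (diag_copies Q M) (diag_copies Q N).
Proof.
have triv a b e : istriv (diag_copies Q (trivmx A a b e)).
  have [c [d [g T]]] : istriv (dsum (1%:M : 'M[A]_(\sum_(i < Q) a))
      (0 : 'M[A]_(\sum_(i < Q) b, \sum_(i < Q) e)))
    := istriv_dsum (istriv_1 _ _) (istriv_0 _ _ _).
  exists c, d, g; apply: mxequiv_trans T.
  by rewrite -diag_copies1 -diag_copies0; apply: diag_copies_dsum.
move=> [a [b [e [a' [b' [e' MN]]]]]].
apply: (steqI (triv a b e) (triv a' b' e')).
apply: mxequiv_trans (mxequiv_sym (diag_copies_dsum _ _ _)) _.
exact: mxequiv_trans (mxequiv_diag_copies Q MN) (diag_copies_dsum _ _ _).
Qed.

End Clifford.

(** * Exactness of the Koszul complex *)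

Section KoszulExactness.
Variables (R : comNzRingType) (D : nat) (f : 'I_D -> R).
Implicit Types (A B : {set 'I_D}) (g h : {set 'I_D} -> R).

(* A function [g] stands for the element [\sum_A g A *: e_A] of the exterior
   algebra. *)
Definition kbd g B : R := \sum_(a | a \notin B) kosz_sign R B a * f a * g (a |: B).

Lemma eq_kbd g h : g =1 h -> kbd g =1 kbd h.
Proof. by move=> gh B; apply: eq_bigr => a _; rewrite gh. Qed.

Lemma kbdD g h B : kbd (fun A => g A + h A) B = kbd g B + kbd h B.
Proof. by rewrite -big_split; apply: eq_bigr => a _; rewrite mulrDr. Qed.

Lemma kbdN g B : kbd (fun A => - g A) B = - kbd g B.
Proof. by rewrite -sumrN; apply: eq_bigr => a _; rewrite mulrN. Qed.

Lemma kbdZ c g B : kbd (fun A => c * g A) B = c * kbd g B.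
Proof. by rewrite mulr_sumr; apply: eq_bigr => a _; rewrite mulrCA. Qed.

Lemma kbd0 g B : (forall a, a \notin B -> g (a |: B) = 0) -> kbd g B = 0.
Proof. by move=> g0; apply: big1 => a aB; rewrite g0 ?mulr0. Qed.

Lemma kosz_sign_setU1 B a : kosz_sign R (a |: B) a = kosz_sign R B a.
Proof.
rewrite /kosz_sign; congr (_ ^+ _); apply: eq_card => c; rewrite !inE.
by case: (eqVneq c a) => [->|//]; rewrite ltnn !andbF.
Qed.

Lemma kbd_coef g B : kbd g B = \sum_A kosz_coef f B A * g A.
Proof.
under [RHS]eq_bigr do rewrite /kosz_coef mulr_suml big_mkcond.
rewrite exchange_big /kbd big_mkcond; apply: eq_bigr => a _ /=.
case: ifP => [aB|/negbFE aB].
  rewrite (bigD1 (a |: B)) //= big1 ?addr0 => [|A /eqP nA].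
    by rewrite setU11 setU1K ?eqxx //= kosz_sign_setU1.
  by case: ifP => // /andP[aA /eqP AB]; case: nA; rewrite -AB setD1K.
rewrite big1 // => A _; case: ifP => // /andP[aA /eqP AB].
by rewrite -AB !inE eqxx in aB.
Qed.

Lemma kosz_coef_card B A : #|A| != #|B|.+1 -> kosz_coef f B A = 0.
Proof.
move=> nAB; rewrite /kosz_coef big_pred0 // => a; apply/negP => /andP[aA /eqP AB].
by rewrite (cardsD1 a A) aA AB add1n eqxx in nAB.
Qed.

(** These are the elements of the exterior algebra on the first [t] generators; exactness is proved
    by induction on [t]. *)
Definition kosz_below t g := forall A (a : 'I_D), a \in A -> (t <= a)%N -> g A = 0.

(** For [h] below [t] this is the wedge of [h] with e_t on the right; no sign appears, since t
    exceeds all indices occurring in [h]. *)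
Definition kosz_wedge (t : 'I_D) h A := if t \in A then h (A :\ t) else 0.

(** The grading involution, which supplies the sign in the Leibniz rule [kbd_wedge]. *)
Definition kosz_flip h A : R := (-1) ^+ #|A| * h A.

Lemma kbd_flip h B : kbd (kosz_flip h) B = - kosz_flip (kbd h) B.
Proof.
rewrite /kosz_flip mulr_sumr -sumrN; apply: eq_bigr => a aB.
by rewrite cardsU1 aB add1n exprS mulN1r mulNr mulrN mulrCA.
Qed.

Lemma kbd_below t h : kosz_below t h -> kosz_below t (kbd h).
Proof.
move=> bh A a aA ta; apply: kbd0 => b _; apply: (bh _ a) => //.
by rewrite inE aA orbT.
Qed.

Lemma kbd_wedge (t : 'I_D) h B : kosz_below t h ->
  kbd (kosz_wedge t h) B = kosz_wedge t (kbd h) B + f t * kosz_flip h B.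
Proof.
move=> bh; rewrite {1}/kbd /kosz_wedge; case: ifP => tB; last first.
  rewrite add0r (bigD1 t) ?tB //= big1 ?addr0 => [|a /andP[aB nat]]; last first.
    by rewrite !inE tB eq_sym (negPf nat) mulr0.
  rewrite setU11 setU1K ?tB // mulrAC mulrC; congr (_ * _).
  (* If [B] has an element at or above [t], both sides vanish; otherwise all of [B] lies below [t]
     and the sign of [t] is (-1)^#|B|. *)
  have [/existsP[c /andP[cB tc]]|] := boolP [exists c, (c \in B) && (t <= c)%N].
    by rewrite /kosz_flip (bh _ c) // !mulr0.
  rewrite negb_exists => /forallP H; congr (_ * _); congr (_ ^+ _).
  apply: eq_card => c; rewrite inE; case cB: (c \in B) => //=.
  by have := H c; rewrite cB /= -ltnNge.
rewrite /kosz_flip (bh _ t) // !mulr0 addr0 /kbd [RHS](bigD1 t) ?inE ?eqxx //=.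
rewrite (bh _ t) ?setU11 // mulr0 add0r; apply: eq_big => [a|a aB].
  by rewrite !inE; case: eqP => [->|_] /=; rewrite ?tB ?andbF ?andbT.
have nat : a != t by apply: contraNneq aB => ->.
have -> : (a |: B) :\ t = a |: B :\ t.
  by apply/setP => c; rewrite !inE; case: (eqVneq c a) => [->|//]; rewrite nat.
rewrite !inE tB orbT; have [ta|ta] := ltnP a t; last first.
  by rewrite (bh _ a) ?setU11 // !mulr0.
congr (_ * _ * _); congr (_ ^+ _); apply: eq_card => c; rewrite !inE.
by case: (eqVneq c t) => [->|//]; rewrite [(t < a)%N]ltnNge ltnW // andbF.
Qed.

(** Induction on [t], splitting [g] as [gg] plus the wedge of [g1] with e_t. The Leibniz rule makes
    [g1] a cycle and the boundary of [gg] equal to minus f_t times the flip of [g1]. First [g1] is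
    written as the boundary of [h1], then [gg] minus f_t times the flip of [h1] as the boundary of
    [h0]. Requiring [h set0 = 0] makes the first result usable in the second step. *)
Lemma kbd_exact t : regular_sequence f -> (t <= D)%N -> forall g, kosz_below t g ->
  kbd g =1 (fun=> 0) -> g set0 = 0 ->
  exists h, [/\ kosz_below t h, h set0 = 0 & kbd h =1 g].
Proof.
move=> rf; elim: t => [|t IH] tD g bg dg g0.
  exists (fun=> 0); split=> // B; rewrite kbd0 //.
  by have [->|[a aB]] := set_0Vmem B; rewrite ?g0 // (bg _ a).
pose tt := Ordinal tD.
pose g1 B := if tt \in B then 0 else g (tt |: B).
pose gg B := if tt \in B then 0 else g B.
have bg1 : kosz_below t g1.
  move=> A a aA ta; rewrite /g1; case: ifPn => // tA.
  apply: (bg _ a); first by rewrite inE aA orbT.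
  by rewrite ltn_neqAle ta andbT; apply: contraNneq tA => E; rewrite (_ : tt = a) //; apply: val_inj.
have bgg : kosz_below t gg.
  move=> A a aA ta; rewrite /gg; case: ifPn => // tA.
  apply: (bg _ a) => //.
  by rewrite ltn_neqAle ta andbT; apply: contraNneq tA => E; rewrite (_ : tt = a) //; apply: val_inj.
have gE A : g A = gg A + kosz_wedge tt g1 A.
  rewrite /gg /kosz_wedge /g1; case: ifP => tA; rewrite ?addr0 //.
  by rewrite !inE eqxx /= setD1K // add0r.
have dE A : kbd gg A + (kosz_wedge tt (kbd g1) A + f tt * kosz_flip g1 A) = 0.
  by rewrite -kbd_wedge // -kbdD -(eq_kbd gE) dg.
have dg1 A : kbd g1 A = 0.
  have [tA|tA] := boolP (tt \in A).
    by apply: (kbd_below bg1 tA).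
  have := dE (tt |: A); rewrite /kosz_wedge setU11 setU1K // /kosz_flip.
  rewrite (kbd_below bgg (setU11 _ _)) // (bg1 _ tt) ?setU11 //.
  by rewrite !mulr0 add0r addr0.
have dgg A : kbd gg A + f tt * kosz_flip g1 A = 0.
  by rewrite -[RHS](dE A) /kosz_wedge; case: ifP; rewrite ?dg1 add0r.
(* In degree zero, the relation for [gg] puts f_t times the constant term of [g1] in the ideal of
   the earlier generators. This is where regularity enters. *)
have [c cE] : in_ideal_before f tt (g1 set0).
  apply: rf; exists (fun k => - gg [set k]).
  have /eqP := dgg set0; rewrite /kosz_flip cards0 mul1r addrC addr_eq0 => /eqP ->.
  rewrite /kbd -sumrN big_mkcond [RHS]big_mkcond; apply: eq_bigr => a _.
  rewrite inE /= setU0; case: ltnP => ta; last by rewrite (bgg _ a) ?inE // mulr0 oppr0.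
  rewrite /kosz_sign (_ : [set _ in _ | _] = set0) ?cards0 ?mul1r; last first.
    by apply/setP => k; rewrite !inE.
  by rewrite mulNr mulrC.
(* A degree-one element whose boundary is the constant term of [g1]; subtracting this boundary makes
   the induction hypothesis applicable to [g1]. *)
pose k1 A := \sum_(k < D | (k < t)%N) c k *+ (A == [set k]).
have k10 : k1 set0 = 0.
  by apply: big1 => k _; rewrite eq_sym -cards_eq0 cards1.
have bk1 : kosz_below t k1.
  move=> A a aA ta; apply: big1 => k kt; case: eqP => // E.
  by move: aA kt; rewrite E inE ltnNge => /eqP <-; rewrite ta.
have dk1 B : kbd k1 B = g1 set0 *+ (B == set0).
  have [->|nB] := eqVneq B set0; last first.
    apply: kbd0 => a aB; apply: big1 => k _; case: eqP => // E.
    case/negP: nB; rewrite -cards_eq0; have := congr1 (fun X : {set _} => #|X|) E.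
    by rewrite cardsU1 aB cards1 add1n => -[->].
  rewrite mulr1n cE /kbd big_mkcond [RHS]big_mkcond; apply: eq_bigr => a _.
  rewrite inE /= setU0 /k1 /kosz_sign (_ : [set _ in _ | _] = set0); last first.
    by apply/setP => k; rewrite !inE.
  rewrite cards0 mul1r; case: ifP => ta.
    rewrite (bigD1 a) //= eqxx mulr1n big1 ?addr0 1?mulrC // => k /andP[_ nk].
    by rewrite (inj_eq set1_inj) eq_sym (negPf nk).
  rewrite big1 ?mulr0 // => k kt; rewrite (inj_eq set1_inj); case: eqP => // E.
  by rewrite E kt in ta.
have [h' [bh' h'0 dh']] : exists h, [/\ kosz_below t h, h set0 = 0 &
    kbd h =1 (fun A => g1 A + - kbd k1 A)].
  apply: IH; first exact: ltnW.
  - by move=> A a aA ta; rewrite (bg1 _ a) // (kbd_below bk1 aA) // subr0.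
  - move=> B; rewrite kbdD kbdN dg1 add0r kbd0 ?oppr0 // => a _.
    rewrite dk1; case: eqP => // E; have := setU11 a B.
    by rewrite E inE.
  - by rewrite dk1 eqxx subrr.
pose h1 A := h' A + k1 A.
have bh1 : kosz_below t h1.
  by move=> A a aA ta; rewrite /h1 (bh' _ a) // (bk1 _ a) // addr0.
have h10 : h1 set0 = 0 by rewrite /h1 h'0 k10 addr0.
have dh1 A : kbd h1 A = g1 A by rewrite kbdD dh' subrK.
(* The correction term makes a cycle because [kbd] anticommutes with [kosz_flip] and [h1] has
   boundary [g1]. *)
have [h0 [bh0 h00 dh0]] : exists h, [/\ kosz_below t h, h set0 = 0 &
    kbd h =1 (fun A => gg A + - (f tt * kosz_flip h1 A))].
  apply: IH; first exact: ltnW.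
  - by move=> A a aA ta; rewrite (bgg _ a) // /kosz_flip (bh1 _ a) // !mulr0 subr0.
  - move=> B; rewrite kbdD kbdN kbdZ kbd_flip mulrN opprK -[RHS](dgg B).
    by congr (_ + _ * _); rewrite /kosz_flip dh1.
  - by rewrite /gg inE g0 /kosz_flip h10 !mulr0 subr0.
exists (fun A => h0 A + kosz_wedge tt h1 A); split.
- move=> A a aA ta; rewrite (bh0 _ a) ?(ltnW ta) // add0r /kosz_wedge.
  case: ifP => // tA; apply: (bh1 _ a) (ltnW ta); rewrite !inE aA andbT.
  by apply: contraTneq ta => ->; rewrite ltnn.
- by rewrite h00 /kosz_wedge inE addr0.
move=> A; rewrite kbdD kbd_wedge // dh0 gE -addrA; congr (_ + _).
rewrite addrCA addNr addr0 /kosz_wedge; by case: ifP.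
Qed.

Lemma regular_kbd_exact g : regular_sequence f ->
  kbd g =1 (fun=> 0) -> g set0 = 0 -> exists h, kbd h =1 g.
Proof.
move=> rf dg g0; have [|h [_ _ dh]] := kbd_exact rf (leqnn D) _ dg g0.
  by move=> A a _; rewrite leqNgt ltn_ord.
by exists h.
Qed.

Definition kosz_fun i (x : 'cV[R]_(kosz_rank D i)) A : R :=
  \sum_s x s 0 *+ (enum_val s == A).

Lemma kosz_funE i (x : 'cV[R]_(kosz_rank D i)) s : kosz_fun x (enum_val s) = x s 0.
Proof.
rewrite /kosz_fun (bigD1 s) //= eqxx mulr1n big1 ?addr0 // => s' /negPf ns.
by rewrite (inj_eq enum_val_inj) ns.
Qed.

Lemma kosz_fun_card i (x : 'cV[R]_(kosz_rank D i)) A : #|A| != i -> kosz_fun x A = 0.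
Proof.
move=> nA; apply: big1 => s _; case: eqP => // E; move: nA; rewrite -E.
by have := enum_valP s; rewrite inE => ->.
Qed.

Lemma sum_kosz_basis i (F : {set 'I_D} -> R) : (forall A, #|A| != i -> F A = 0) ->
  \sum_A F A = \sum_(s < kosz_rank D i) F (enum_val s).
Proof.
move=> F0; rewrite [RHS](_ : _ = \sum_(A in kosz_basis D i) F A); last first.
  by rewrite [RHS]big_enum_val.
rewrite [RHS]big_mkcond; apply: eq_bigr => A _; rewrite inE.
by case: ifPn => // /F0.
Qed.

Lemma kosz_basis_card i (s : 'I_(kosz_rank D i)) : #|enum_val s| = i.
Proof. by apply/eqP; have := enum_valP s; rewrite inE. Qed.

Lemma kbd_kosz_fun i (x : 'cV[R]_(kosz_rank D i.+1)) (s : 'I_(kosz_rank D i)) :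
  kbd (kosz_fun x) (enum_val s) = (koszul f i.+1 *m x) s 0.
Proof.
rewrite kbd_coef mxE (sum_kosz_basis (i := i.+1)) => [|A nA]; last first.
  by rewrite kosz_fun_card // mulr0.
by apply: eq_bigr => t _; rewrite mxE kosz_funE.
Qed.

Lemma koszul_exact i : regular_sequence f ->
  exact_pair (koszul f i.+1) (koszul f i.+2).
Proof.
move=> rf x; split=> [dx|[y ->]]; last by rewrite mulmxA koszul_koszul mul0mx.
have [B||h dh] := @regular_kbd_exact (kosz_fun x) rf.
- have [cB|nB] := eqVneq #|B| i; last first.
    by apply: kbd0 => a aB; apply: kosz_fun_card; rewrite cardsU1 aB.
  have Bb : B \in kosz_basis D i by rewrite inE cB.
  by rewrite -(enum_rankK_in Bb Bb) kbd_kosz_fun dx mxE.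
- by apply: kosz_fun_card; rewrite cards0.
(* Only the components of [h] on sets of size [i.+2] contribute to the boundary in degree [i.+1]. *)
exists (\col_t h (enum_val t)); apply/colP => s; rewrite -kosz_funE -dh kbd_coef mxE.
rewrite (sum_kosz_basis (i := i.+2)) => [|A nA]; last first.
  by rewrite kosz_coef_card ?mul0r // kosz_basis_card.
by apply: eq_bigr => t _; rewrite !mxE.
Qed.

(** Up to a factor depending only on the size of [A], this is the sign of the permutation that lists
    [A] before its complement. *)
Definition kosz_total_sign A : R := (-1) ^+ (\sum_(a in A) a).

Lemma kosz_total_signK A : kosz_total_sign A * kosz_total_sign A = 1.
Proof. by rewrite /kosz_total_sign -expr2 sqrr_sign. Qed.

(* Self-duality of the Koszul complex under [A |-> ~: A]. *)
Lemma kosz_coefC B A : kosz_coef f B A =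
  kosz_total_sign A * kosz_total_sign B * kosz_coef f (~: A) (~: B).
Proof.
rewrite /kosz_coef mulr_sumr; apply: eq_big => [a|a /andP[aA /eqP AB]].
  rewrite inE; apply/andP/andP => -[H /eqP E].
    split; first by rewrite -E !inE eqxx.
    by rewrite -E; apply/eqP/setP => c; rewrite !inE; case: (eqVneq c a) => [->|//]; rewrite H.
  have aA : a \in A.
    by have /setP/(_ a) := E; rewrite !inE eqxx /= => /esym/negbFE.
  split=> //; apply/eqP/setP => c; have /setP/(_ c) := E; rewrite !inE.
  by case: (eqVneq c a) => [->|_] /=; [rewrite (negPf H) | move/negb_inj].
rewrite mulrA; congr (_ * _).
have aB : a \notin B by rewrite -AB !inE eqxx.
have -> : kosz_total_sign A * kosz_total_sign B = (-1) ^+ a.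
  rewrite /kosz_total_sign (bigD1 a) //= exprD -mulrA.
  rewrite (_ : (\sum_(i in A | i != a) i)%N = (\sum_(i in B) i)%N); last first.
    by apply: eq_bigl => c; rewrite -AB !inE andbC.
  by rewrite -expr2 sqrr_sign mulr1.
(* Every index below [a] lies in exactly one of [A] and [~: B], so the two Koszul signs at [a]
   multiply to (-1)^a. *)
pose X := [set c in A | (c < a)%N]; pose Y := [set c in ~: B | (c < a)%N].
have XY : #|X :|: Y| = a.
  rewrite -[RHS]card_ord -[RHS](@card_imset _ _ (widen_ord (ltnW (ltn_ord a)))); last first.
    by move=> u v /(congr1 val) /= /val_inj.
  apply: eq_card => c; rewrite !inE -andb_orl.
  apply/andP/imsetP => [[_ ca]|[u _ ->]].
    by exists (Ordinal ca) => //; apply: val_inj.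
  split; last exact: (ltn_ord u).
  rewrite -AB !inE; set w := widen_ord _ _; case: (w \in A); rewrite ?orbT //.
  by rewrite andbF.
have dXY : [disjoint X & Y].
  rewrite -setI_eq0; apply/eqP/setP => c; rewrite !inE -AB !inE.
  case: (eqVneq c a) => [->|_]; first by rewrite ltnn !andbF.
  by case: (c \in A); rewrite /= ?andbF.
rewrite -[in (-1) ^+ nat_of_ord a]XY cardsU (disjoint_setI0 dXY) cards0 subn0 exprD.
by rewrite -mulrA -/Y -expr2 sqrr_sign mulr1.
Qed.

(** Complementation, with the signs [s], turns the transposed differentials into Koszul
    differentials. The bound on [i] ensures that the cycle [g] corresponding to [x] has no constant
    term. *)
Lemma koszul_tr_exact i : regular_sequence f -> (i.+1 < D)%N ->
  exact_pair (koszul f i.+2)^T (koszul f i.+1)^T.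
Proof.
move=> rf iD x; split=> [dx|[y ->]]; last first.
  by rewrite mulmxA -trmx_mul koszul_koszul trmx0 mul0mx.
pose s := kosz_total_sign.
pose g C := s (~: C) * kosz_fun x (~: C).
have reC (F : {set 'I_D} -> R) : \sum_C F C = \sum_C F (~: C).
  by apply: reindex; exists (@setC _) => C _; rewrite setCK.
have [C||h dh] := @regular_kbd_exact g rf.
- rewrite kbd_coef reC -[C]setCK; move: (~: C) => A.
  have -> : \sum_B kosz_coef f (~: A) (~: B) * g (~: B) =
            s A * \sum_B kosz_coef f B A * kosz_fun x B.
    rewrite mulr_sumr; apply: eq_bigr => B _; rewrite /g setCK [kosz_coef f B A]kosz_coefC.
    by rewrite -/(s A) -/(s B) !mulrA kosz_total_signK mul1r -!mulrA mulrCA.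
  rewrite (sum_kosz_basis (i := i.+1)) => [|B nB]; last first.
    by rewrite kosz_fun_card // mulr0.
  have [cA|nA] := eqVneq #|A| i.+2; last first.
    rewrite big1 ?mulr0 // => t _; rewrite kosz_coef_card ?mul0r //.
    by rewrite kosz_basis_card.
  have Ab : A \in kosz_basis D i.+2 by rewrite inE cA.
  have /colP/(_ (enum_rank_in Ab A)) := dx; rewrite !mxE => E.
  rewrite -[X in _ * X = _](_ : 0 = _) ?mulr0 // -[LHS]E; apply: eq_bigr => t _.
  by rewrite !mxE kosz_funE enum_rankK_in.
- by rewrite /g setC0 kosz_fun_card ?mulr0 // cardsT card_ord gtn_eqF.
exists (\col_t (s (enum_val t) * h (~: enum_val t))); apply/colP => u.
set B := enum_val u.
have -> : x u 0 = s B * g (~: B).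
  by rewrite /g setCK mulrA kosz_total_signK mul1r kosz_funE.
rewrite -dh kbd_coef reC mulr_sumr (sum_kosz_basis (i := i)) => [|A nA]; last first.
  rewrite kosz_coef_card ?mul0r ?mulr0 //; apply: contraNneq nA => E.
  have := cardsC A; have := cardsC B; rewrite {1}/B kosz_basis_card E => <-.
  by rewrite addSnnS => /addIn ->.
rewrite mxE; apply: eq_bigr => t _; rewrite !mxE -/B [kosz_coef f _ B]kosz_coefC.
rewrite -/(s B) -/(s _) !mulrA; congr (_ * _).
by rewrite [RHS]mulrAC -(mulrA (s B)) kosz_total_signK mulr1.
Qed.

End KoszulExactness.

(** * Restriction of scalars and the toric ideal *)

Section Augmentation.
Variables (K : comNzRingType) (G : zmodType).

Definition gaug (r : galg K G) : K := \sum_(v <- msupp r) r@_v.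

Lemma gaugB : {morph gaug : a b / a - b}.
Proof. by apply: (@gsumB _ _ _ (fun c _ => c)). Qed.

Lemma gaugU c v : gaug << c *g v >> = c.
Proof. by apply: (@gsumU _ _ _ (fun c _ => c)). Qed.

Lemma gaug_mon_sub1 v : gaug (mon K v - 1) = 0.
Proof. by rewrite gaugB -mon0 !monE !gaugU subrr. Qed.

Lemma gaugM a b : gaug (a * b) = gaug a * gaug b.
Proof.
move: b; apply: galg_ext => [x y|x y|c v]; rewrite ?mulrBr ?gaugB ?mulrBr //.
move: a; apply: galg_ext => [x y|x y|d w]; rewrite ?mulrBl ?gaugB ?mulrBl //.
by rewrite galgUU !gaugU.
Qed.

End Augmentation.

Section Pushforward.
Variables (K : comNzRingType) (G H : zmodType) (phi : {additive G -> H}).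

Definition gpush (r : galg K G) : galg K H :=
  \sum_(v <- msupp r) << r@_v *g phi v >>.

Lemma gpushB : {morph gpush : a b / a - b}.
Proof.
by apply: (@gsumB _ _ _ (fun c v => << c *g phi v >>)) => v a b; rewrite monalgUB.
Qed.

Lemma gpushU c v : gpush << c *g v >> = << c *g phi v >>.
Proof.
by apply: (@gsumU _ _ _ (fun c v => << c *g phi v >>)) => u; rewrite monalgU0.
Qed.

Lemma gpush_mon v : gpush (mon K v) = mon K (phi v).
Proof. by rewrite !monE gpushU. Qed.

Lemma gpush_monoid : monoid_morphism gpush.
Proof.
split; first by rewrite -!mon0 gpush_mon raddf0.
move=> a b; move: a b; apply: galg_ext2 => [g a b|g a b|g a b|g a b|c d v w].
- by rewrite mulrBl gpushB.
- by rewrite mulrBr gpushB.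
- by rewrite gpushB mulrBl.
- by rewrite gpushB mulrBr.
by rewrite galgUU !gpushU galgUU raddfD.
Qed.

HB.instance Definition _ := GRing.isZmodMorphism.Build _ _ gpush gpushB.
HB.instance Definition _ := GRing.isMonoidMorphism.Build _ _ gpush gpush_monoid.

Lemma gaug_gpush r : gaug (gpush r) = gaug r.
Proof.
move: r; apply: galg_ext => [a b|a b|c v]; rewrite ?gpushB ?gaugB //.
by rewrite gpushU !gaugU.
Qed.

End Pushforward.

Section Restriction.
Variables (V : zmodType) (L : zmodClosed V) (T : coset_reps L) (K : comNzRingType).
Local Notation A := (galg K (sublattice L)).
Local Notation R := (galg K V).
Local Notation N := (cr_index T).
Local Notation u := (@cr_rep V L T).
Local Notation iota := (@gpush K (sublattice L) V \val).

(** The isomorphism from coordinate columns to [R] given by the coset representatives; in these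
    coordinates [res_elt T r] is multiplication by [r], by [comb_res]. *)
Definition comb (x : 'cV[A]_N) : R := \sum_i iota (x i 0) * mon K (u i).

Lemma combB : {morph comb : x y / x - y}.
Proof.
move=> x y; rewrite -sumrB; apply: eq_bigr => i _.
by rewrite !mxE rmorphB mulrBl.
Qed.

Lemma comb0 : comb 0 = 0.
Proof. exact: morphB0 combB. Qed.

Lemma combZ a x : comb (a *: x) = iota a * comb x.
Proof.
rewrite mulr_sumr; apply: eq_bigr => i _.
by rewrite mxE rmorphM mulrA.
Qed.

Lemma comb_transl v x : comb (transl_mx T K v *m x) = mon K v * comb x.
Proof.
rewrite mulr_sumr /comb.
under eq_bigr do rewrite mxE rmorph_sum mulr_suml.
rewrite exchange_big; apply: eq_bigr => k _ /=.
have [i [l [E tE]]] := transl_mxP (T := T) K v k.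
rewrite (bigD1 i) //= tE eqxx mulr1n big1 ?addr0 => [|i' /negPf ni]; last first.
  by rewrite tE ni mulr0n mul0r rmorph0 mul0r.
rewrite rmorphM /= gpush_mon mulrAC -monD addrC -E monD -mulrA.
by rewrite [mon K (u k) * _]mulrC.
Qed.

Lemma comb_res r x : comb (res_elt T r *m x) = r * comb x.
Proof.
move: r; apply: galg_ext => [a b|a b|c v].
- by rewrite res_eltB mulmxBl combB.
- by rewrite mulrBl.
rewrite res_eltU -scalemxAl combZ comb_transl mulrA gpushU raddf0 monE galgUU.
by rewrite mulr1 add0r.
Qed.

Lemma comb_onto r : exists x, comb x = r.
Proof.
(* The representative [u k0] lies in [L], so the monomial with exponent [- u k0], placed in
   coordinate [k0], represents 1. Acting by [res_elt T r] then gives [r]. *)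
have [k0 [uk0 _]] := cr_repP T 0; rewrite sub0r in uk0.
pose l : sublattice L := Sublattice uk0.
pose e : 'cV[A]_N := \col_i (mon K l *+ (i == k0)).
exists (res_elt T r *m e); rewrite comb_res.
rewrite /comb (bigD1 k0) //= mxE eqxx mulr1n gpush_mon /= -monD addNr mon0.
rewrite big1 ?addr0 ?mulr1 // => i /negPf ni.
by rewrite mxE ni mulr0n rmorph0 mul0r.
Qed.

Lemma mcoeff_iota_mon (a : A) v w :
  (iota a * mon K v)@_w = if insub (w - v) is Some l then a@_l else 0.
Proof.
move: a; apply: galg_ext => [a b|a b|c l].
- by rewrite rmorphB mulrBl mcoeffB.
- by case: insubP => [l _ _|_]; rewrite ?mcoeffB ?subr0.
rewrite gpushU monE galgUU mulr1 mcoeffU.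
case: insubP => [l' _ E|nL]; rewrite ?mcoeffU.
  congr (_ *+ _); rewrite -[l == l'](inj_eq val_inj) E.
  by rewrite [in RHS]eq_sym subr_eq eq_sym.
case: eqP => // E; case/negP: nL.
by rewrite -E addrK; apply: valP.
Qed.

(** The coefficient at [val l + u k] sees only the summand [k], since the other representatives lie
    in different cosets. *)
Lemma comb_inj x : comb x = 0 -> x = 0.
Proof.
move=> x0; apply/colP => k; apply/malgP => l; rewrite mxE mcoeff0.
have /(congr1 (fun r => r@_(val l + u k))) := x0; rewrite mcoeff0 raddf_sum /=.
rewrite (bigD1 k) //= mcoeff_iota_mon addrK valK big1 ?addr0 // => i /negP ni.
rewrite mcoeff_iota_mon; case: insubP => // l' hl' _; case: ni.
apply/eqP/(cr_rep_eq (T := T)); rewrite -opprB rpredN -[_ - _](addKr (val l)).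
by rewrite rpredD ?rpredN ?addrA //; apply: valP.
Qed.

Definition ext_cols n (x : 'cV[A]_(\sum_(i < n) N)) : 'cV[R]_n :=
  \col_i comb (submxcol x i).

Lemma ext_colsB n : {morph @ext_cols n : x y / x - y}.
Proof. by move=> x y; apply/colP => i; rewrite !mxE submxcolB combB. Qed.

Lemma ext_colsZ n a (x : 'cV[A]_(\sum_(i < n) N)) :
  ext_cols (a *: x) = iota a *: ext_cols x.
Proof.
apply/colP => i; rewrite !mxE -combZ; congr comb.
by apply/colP => k; rewrite !mxE.
Qed.

Lemma ext_cols_res m n (M : 'M[R]_(m, n)) x :
  ext_cols (res_mx T M *m x) = M *m ext_cols x.
Proof.
apply/colP => i; rewrite !mxE -{1}[x]submxcolK -submxcol_mul submxcol_matrix.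
rewrite mul_mxrow_mxcol (big_morph _ (morphBD combB) comb0).
by apply: eq_bigr => k _; rewrite mxE comb_res.
Qed.

Lemma ext_cols_onto n (y : 'cV[R]_n) : exists x, ext_cols x = y.
Proof.
have /fin_all_exists[x Hx] : forall i, exists x, comb x = y i 0.
  by move=> i; apply: comb_onto.
by exists (\mxcol_i x i); apply/colP => i; rewrite mxE mxcolK.
Qed.

Lemma ext_cols_inj n : injective (@ext_cols n).
Proof.
move=> x y xy; apply/eqP; rewrite -subr_eq0; apply/eqP/mxcolP => i.
rewrite submxcol0; apply: comb_inj.
have : ext_cols (x - y) = 0 by rewrite ext_colsB xy subrr.
by move/colP/(_ i); rewrite !mxE.
Qed.

Lemma res_mx_image m n (M : 'M[R]_(m, n)) x :
  (exists y, x = res_mx T M *m y) <-> (exists y, ext_cols x = M *m y).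
Proof.
split=> [[y ->]|[y]]; first by exists (ext_cols y); rewrite ext_cols_res.
have [y' <-] := ext_cols_onto y; rewrite -ext_cols_res => /ext_cols_inj ->.
by exists y'.
Qed.

Lemma exact_res_mx m n l (P : 'M[R]_(m, n)) (Q : 'M[R]_(n, l)) :
  exact_pair P Q -> exact_pair (res_mx T P) (res_mx T Q).
Proof.
move=> E x; rewrite res_mx_image -E -ext_cols_res; split=> [->|H].
  exact: morphB0 (@ext_colsB _).
by apply: ext_cols_inj; rewrite H; apply/esym/morphB0/ext_colsB.
Qed.

End Restriction.

(** * Exactness under conjugation and direct copies *)

Section DaggerExact.
Variables (K : comNzRingType) (G : zmodType).
Local Notation A := (galg K G).

Lemma map_gbarK m n (M : 'M[A]_(m, n)) : map_mx (@gbar K G) (map_mx (@gbar K G) M) = M.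
Proof. by apply/matrixP => i k; rewrite !mxE gbarK. Qed.

Lemma exact_gbar m n l (P : 'M[A]_(m, n)) (Q : 'M[A]_(n, l)) :
  exact_pair P Q -> exact_pair (map_mx (@gbar K G) P) (map_mx (@gbar K G) Q).
Proof.
move=> E x; split=> [Px|[y ->]].
  have /E[y Hy] : P *m map_mx (@gbar K G) x = 0.
    by rewrite -[P]map_gbarK -map_mxM Px map_mx0.
  by exists (map_mx (@gbar K G) y); rewrite -[x]map_gbarK Hy map_mxM.
have PQ : P *m (Q *m map_mx (@gbar K G) y) = 0 by apply/E; eexists.
by have := congr1 (map_mx (@gbar K G)) PQ; rewrite !map_mxM map_gbarK map_mx0.
Qed.

Lemma exact_dag m n l (P : 'M[A]_(n, m)) (Q : 'M[A]_(l, n)) :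
  exact_pair P^T Q^T -> exact_pair (dag P) (dag Q).
Proof. by rewrite /dag !map_trmx; apply: exact_gbar. Qed.

Lemma submxcol_diag_copies q m n (M : 'M[A]_(m, n)) (x : 'cV_(\sum_(i < q) n)) i :
  submxcol (diag_copies q M *m x) i = M *m submxcol x i.
Proof.
rewrite -{1}[x]submxcolK -submxcol_mul submxcol_matrix mul_mxrow_mxcol.
rewrite (bigD1 i) //= eqxx big1 ?addr0 // => k /negPf ki.
by rewrite eq_sym ki mul0mx.
Qed.

Lemma diag_copies_image q m n (M : 'M[A]_(m, n)) (x : 'cV_(\sum_(i < q) m)) :
  (exists y, x = diag_copies q M *m y) <->
  (forall i, exists y, submxcol x i = M *m y).
Proof.
split=> [[y ->] i|/fin_all_exists[y Hy]].
  by exists (submxcol y i); rewrite submxcol_diag_copies.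
exists (\mxcol_i y i); apply/mxcolP => i.
by rewrite submxcol_diag_copies mxcolK.
Qed.

Lemma exact_diag_copies q m n l (P : 'M[A]_(m, n)) (Q : 'M[A]_(n, l)) :
  exact_pair P Q -> exact_pair (diag_copies q P) (diag_copies q Q).
Proof.
move=> E x; rewrite diag_copies_image; split=> [Px i|H].
  by apply/E; rewrite -submxcol_diag_copies Px submxcol0.
apply/mxcolP => i; rewrite submxcol_diag_copies submxcol0.
exact/E.
Qed.

End DaggerExact.

(** * Ideals of initial segments and the toric sequence *)

Section IdealBelow.
Variables (R : comNzRingType) (D : nat) (f : 'I_D -> R).

(** With [t] a natural number, this covers [in_ideal_before] by conversion as well as the full
    ideal, at [t = D]. *)
Definition ideal_below t (r : R) :=
  exists g : 'I_D -> R, r = \sum_(k < D | (k < t)%N) g k * f k.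

Lemma ideal_belowB t a b : ideal_below t a -> ideal_below t b -> ideal_below t (a - b).
Proof.
move=> [g ->] [h ->]; exists (fun k => g k - h k).
by rewrite -sumrB; apply: eq_bigr => k _; rewrite mulrBl.
Qed.

Lemma ideal_belowM t a b : ideal_below t b -> ideal_below t (a * b).
Proof.
move=> [g ->]; exists (fun k => a * g k).
by rewrite mulr_sumr; apply: eq_bigr => k _; rewrite mulrA.
Qed.

Lemma ideal_below0 t : ideal_below t 0.
Proof. by exists (fun=> 0); rewrite big1 // => k _; rewrite mul0r. Qed.

Lemma ideal_belowD t a b : ideal_below t a -> ideal_below t b -> ideal_below t (a + b).
Proof.
move=> Ia Ib; rewrite -[b]opprK -[- b]sub0r.
by apply: ideal_belowB => //; apply: ideal_belowB => //; apply: ideal_below0.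
Qed.

Lemma in_idealP r : in_ideal f r <-> ideal_below D r.
Proof. by split=> -[g ->]; exists g; apply: eq_bigl => k; rewrite ltn_ord. Qed.

End IdealBelow.

Section ToricIdeal.
Variables (K : comNzRingType) (D : nat).
Local Notation toric_ideal := (ideal_below (@toric_seq D K)).
Local Notation R := (laurent K D).

(** On group algebras this sets the first [t] variables to 1; by [gpush_drop_ideal], the kernel is
    the ideal of the first [t] toric generators. *)
Definition drop_below t (v : 'rV[int]_D) : 'rV[int]_D :=
  \row_k (if (k < t)%N then 0 else v 0 k).

Lemma drop_belowB t : {morph drop_below t : v w / v - w}.
Proof. by move=> v w; apply/rowP => k; rewrite !mxE; case: ifP; rewrite ?subr0. Qed.

HB.instance Definition _ t :=
  GRing.isZmodMorphism.Build _ _ (drop_below t) (@drop_belowB t).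

Lemma toric_ideal_monB t v w :
  toric_ideal t (mon K v - 1) -> toric_ideal t (mon K w - 1) ->
  toric_ideal t (mon K (v - w) - 1).
Proof.
move=> Iv Iw; have -> : mon K (v - w) - 1 =
    mon K (- w) * ((mon K v - 1) - (mon K w - 1)) :> R.
  by rewrite opprB addrA subrK mulrBr -!monD addNr mon0 [- w + v]addrC.
exact/ideal_belowM/ideal_belowB.
Qed.

(** The exponents w with x^w - 1 in the ideal form a subgroup, and it contains the first [t] unit
    vectors. *)
Lemma toric_ideal_mon_drop t v : toric_ideal t (mon K (v - drop_below t v) - 1).
Proof.
pose P w := toric_ideal t (mon K w - 1).
have P0 : P 0 by rewrite /P mon0 subrr; apply: ideal_below0.
have PN w : P w -> P (- w) by move=> Pw; rewrite -sub0r; apply: toric_ideal_monB.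
have PD w w' : P w -> P w' -> P (w + w').
  by move=> Pw Pw'; rewrite -[w']opprK; apply: toric_ideal_monB => //; apply: PN.
have Pn w n : P w -> P (w *+ n).
  by move=> Pw; elim: n => [|n IH]; rewrite ?mulr0n // mulrS; apply: PD.
rewrite -/(P _) [_ - _]row_sum_delta; apply: (big_ind P) => // k _.
rewrite !mxE; case: ifP => kt; last by rewrite subrr scale0r.
rewrite subr0.
have Pe : P (delta_mx 0 k).
  exists (fun i => (i == k)%:R); rewrite (bigD1 k) //= eqxx mul1r big1 ?addr0 //.
  by move=> i /andP[_ /negPf ->]; rewrite mul0r.
have Pz n : P (n%:Z *: delta_mx 0 k) by rewrite -natz scaler_nat; apply: Pn.
by case: (v 0 k) => n //; rewrite NegzE scaleNr; apply: PN.
Qed.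

Lemma toric_ideal_drop t (r : R) : toric_ideal t (r - gpush (drop_below t) r).
Proof.
rewrite {1}[r]monalgE /gpush -sumrB.
apply: (big_ind (toric_ideal t)) => [||v _]; first exact: ideal_below0.
  exact: ideal_belowD.
have -> : << r@_v *g v >> - << r@_v *g drop_below t v >> =
    (<< r@_v *g drop_below t v >> : R) * (mon K (v - drop_below t v) - 1) :> R.
  by rewrite mulrBr mulr1 monE galgUU mulr1 [drop_below t v + _]addrC subrK.
exact/ideal_belowM/toric_ideal_mon_drop.
Qed.

Lemma gpush_drop_toric t (k : 'I_D) :
  gpush (drop_below t) (toric_seq K k) = if (k < t)%N then 0 else toric_seq K k.
Proof.
rewrite rmorphB rmorph1 /= gpush_mon /=.
have -> : drop_below t (delta_mx 0 k) = if (k < t)%N then 0 else delta_mx 0 k.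
  apply/rowP => i; rewrite !mxE; case: (eqVneq i k) => [->|ik].
    by case: ifP; rewrite !mxE ?eqxx.
  by do 2!case: ifP => _; rewrite !mxE // ?andbF // (negPf ik) andbF.
by case: ifP; rewrite ?mon0 ?subrr.
Qed.

Lemma gpush_drop_ideal t (r : R) :
  gpush (drop_below t) r = 0 <-> toric_ideal t r.
Proof.
split=> [r0|[g ->]]; first by have := toric_ideal_drop t r; rewrite r0 subr0.
rewrite rmorph_sum big1 // => k kt.
by rewrite rmorphM /= gpush_drop_toric kt mulr0.
Qed.

(** The hypothesis makes the coefficients of [r] constant along the direction [e]. A nonzero one
    would give [(size (msupp r)).+1] distinct points in the support. *)
Lemma toric_seq_nonzerodivisor k (r : R) : toric_seq K k * r = 0 -> r = 0.
Proof.
move=> xr0; set e : 'rV[int]_D := delta_mx 0 k.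
have xr : mon K e * r = r by apply/eqP; rewrite -subr_eq0 -{2}[r]mul1r -mulrBl xr0.
have xE (s : R) w : (mon K e * s)@_(e + w) = s@_w.
  move: s; apply: galg_ext => [a b|a b|c v]; rewrite ?mulrBr ?mcoeffB //.
  by rewrite monE galgUU mul1r !mcoeffU (inj_eq (addrI e)).
have rE w n : r@_(e *+ n + w) = r@_w.
  by elim: n => [|n IH]; rewrite ?mulr0n ?add0r // mulrS -addrA -{1}xr xE.
apply/malgP => w; rewrite mcoeff0; apply/eqP; apply: contraT => rw.
have eE n : (e *+ n) 0 k = n%:Z by rewrite mulmxnE mxE !eqxx -natz.
pose s := [seq e *+ n + w | n <- iota 0 (size (msupp r)).+1].
have us : uniq s.
  rewrite map_inj_uniq ?iota_uniq // => n n' /addIr.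
  by move=> /(congr1 (fun v : 'rV[int]_D => v 0 k)); rewrite !eE => -[].
have sr : {subset s <= msupp r}.
  by move=> _ /mapP[n _ ->]; rewrite -mcoeff_neq0 rE.
by have := uniq_leq_size us sr; rewrite size_map size_iota ltnn.
Qed.

(** Setting the earlier variables to 1 turns membership in their ideal into vanishing and leaves the
    generator [i] unchanged. *)
Lemma toric_seq_regular : regular_sequence (toric_seq K : 'I_D -> R).
Proof.
move=> i r /gpush_drop_ideal; rewrite rmorphM /= gpush_drop_toric ltnn.
by move=> /toric_seq_nonzerodivisor/gpush_drop_ideal.
Qed.

Lemma in_toric_ideal (r : R) : in_ideal (toric_seq K) r <-> gaug r = 0.
Proof.
have E : gpush (drop_below D) r = << gaug r *g 0 >>.
  move: r; apply: galg_ext => [a b|a b|c v]; rewrite ?rmorphB ?gaugB ?monalgUB //.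
  rewrite gpushU gaugU; congr (<< _ *g _ >>).
  by apply/rowP => k; rewrite !mxE ltn_ord.
rewrite in_idealP -gpush_drop_ideal E; split=> [/eqP|->]; last exact: monalgU0.
by rewrite monalgU_eq0 => /eqP.
Qed.

End ToricIdeal.

(** * Elementary expansions *)

Section Expansions.
Variable G : zmodType.
Local Notation A := (galg int G).

Lemma signed_translate_unit (s : A) : signed_translate s -> exists s', s' * s = 1.
Proof.
move=> [b [v ->]]; exists ((-1) ^+ b * mon int (- v)).
by rewrite mulrACA -expr2 sqrr_sign mul1r -monD addNr mon0.
Qed.

(** The left inverse carries the inverses of the signed translates; it inverts [M] on both sides for
    chains supported on the image of [iota]. *)
Lemma cell_injection_inv m n (iota : 'I_n -> 'I_m) (M : 'M[A]_(m, n)) :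
  cell_injection iota M -> exists M' : 'M[A]_(n, m), M' *m M = 1%:M /\
    forall y : 'cV_m, (forall a, a \notin codom iota -> y a 0 = 0) ->
    M *m (M' *m y) = y.
Proof.
move=> [inj Mi].
have /fin_all_exists2[s s1 sM] : forall b, exists2 s : A * A, s.2 * s.1 = 1 &
    forall a, M a b = s.1 *+ (a == iota b).
  move=> b; have [s us sM] := Mi b; have [s' s's] := signed_translate_unit us.
  by exists (s, s').
exists (\matrix_(b, a) ((s b).2 *+ (a == iota b))); split.
  apply/matrixP => b b'; rewrite !mxE (bigD1 (iota b)) //= big1 ?addr0.
    rewrite !mxE eqxx mulr1n sM (inj_eq inj).
    by case: eqP => [->|_]; rewrite ?mulr1n ?s1 ?mulr0n ?mulr0.
  by move=> a /negPf na; rewrite mxE na mulr0n mul0r.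
move=> y y0; apply/colP => a; rewrite mxE.
have My b : (\matrix_(b, a) ((s b).2 *+ (a == iota b)) *m y) b 0 = (s b).2 * y (iota b) 0.
  rewrite mxE (bigD1 (iota b)) //= mxE eqxx mulr1n big1 ?addr0 //.
  by move=> a' /negPf na; rewrite mxE na mulr0n mul0r.
have [/codomP[b ->]|na] := boolP (a \in codom iota).
  rewrite (bigD1 b) //= big1 ?addr0 => [|b' nb].
    by rewrite sM eqxx mulr1n My mulrA [_ * (s b).2]mulrC s1 mul1r.
  by rewrite sM (inj_eq inj) eq_sym (negPf nb) mulr0n mul0r.
rewrite y0 // big1 // => b _; rewrite sM; case: eqP => [E|_].
  by rewrite E codom_f in na.
by rewrite mulr0n mul0r.
Qed.

(** By counting, the image of [iota] omits at most one index, and [e] is omitted. *)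
Lemma codom_almost m n (iota : 'I_n -> 'I_m) e : injective iota -> (m <= n.+1)%N ->
  e \notin codom iota -> forall a, a != e -> a \in codom iota.
Proof.
move=> inj mn ne a nae; apply: contraT => na.
have /subset_leq_card : codom iota \subset [set~ a] :\ e.
  apply/subsetP => b bi; rewrite !inE.
  by apply/andP; split; [apply: contraNneq ne | apply: contraNneq na] => <-.
have := cardsD1 e [set~ a]; rewrite !inE eq_sym nae cardsC1 card_ord add1n => E.
rewrite card_codom // card_ord => le.
by move: mn; rewrite leqNgt -[m]prednK ?(leq_trans _ (ltn_ord e)) // E !ltnS le.
Qed.

(** The split injection [J i] only adds trivial rows, so [pc_bd C' i.+1] is compared with its
    restriction to the cells of [C]. The cases are: the added cell of dimension [i.+1] is [e], it is
    [e'], or there is none. *)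
Lemma steq_expansion (C C' : periodic_complex G) i : elementary_expansion C C' ->
  steq (pc_bd C i.+1) (pc_bd C' i.+1).
Proof.
move=> [k [iota [J [e [e' [rk injJ comm [ne ne'] ue]]]]]].
have inj l : injective (iota l) by case: (injJ l).
have [J1 [J1J _]] := cell_injection_inv (injJ i).
have [J' [J'J JJ']] := cell_injection_inv (injJ i.+1).
have JN : J i *m pc_bd C i.+1 = pc_bd C' i.+1 *m J i.+1 by rewrite [RHS]comm.
apply: steq_trans (steq_sym (steq_mull _ J1J)) _; rewrite JN.
have [u uE] := signed_translate_unit ue.
have [E|nik] := eqVneq k i.+1.
  subst k; apply: steq_same_image => y; first by exists (J i.+1 *m y); rewrite mulmxA.
  (* The boundary of [e'] is a cycle with a unit coefficient at [e]; subtracting a multiple moves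
     any chain off [e] without changing its boundary. *)
  pose w := col e' (pc_bd C' i.+2).
  have dw : pc_bd C' i.+1 *m w = 0 by rewrite /w colE mulmxA pc_bd_bd mul0mx.
  exists (J' *m (y - (u * y e 0) *: w)).
  rewrite -mulmxA JJ' => [|a na].
    by rewrite mulmxBr -scalemxAr dw scaler0 subr0.
  have [->|nae] := eqVneq a e.
    by rewrite !mxE mulrAC uE mul1r subrr.
  case/negP: na; apply: codom_almost nae => //.
  by rewrite rk eqxx (ltn_eqF (ltnSn _)) addn0 addn1.
have [E|ni1k] := eqVneq k i.
  subst k; set N := pc_bd C' i.+1; set M := N *m J i.+1.
  (* The functional [lam] reads the coefficient at [e], normalized to be 1 on the boundary of [e'];
     it vanishes on boundaries of cells of [C], which do not meet [e]. *)
  pose w := col e' N; pose lam : 'rV[A]_(pc_rank C' i) := u *: delta_mx 0 e.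
  have lw : lam *m w = 1%:M.
    apply/matrixP => x y; rewrite !ord1 /lam -scalemxAl -rowE !mxE uE.
    by rewrite eqxx.
  have lM : lam *m M = 0.
    rewrite /M -JN mulmxA (_ : lam *m J i = 0) ?mul0mx //.
    apply/rowP => b; rewrite /lam -scalemxAl -rowE !mxE.
    have [_ /(_ b)[s _ ->]] := injJ i; case: eqP => [E|_]; last by rewrite mulr0n mulr0.
    by rewrite E codom_f in ne.
  apply: (steq_split_col lM lw) => [y|x t].
    exists (J' *m (y - y e' 0 *: delta_mx e' 0)), (y e' 0).
    rewrite -mulmxA JJ' => [|a na].
      by rewrite mulmxBr -scalemxAr -colE subrK.
    have [->|nae] := eqVneq a e'; first by rewrite !mxE !eqxx mulr1 subrr.
    case/negP: na; apply: codom_almost nae => //.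
    by rewrite rk eqxx (gtn_eqF (ltnSn _)) addn0 addn1.
  exists (J i.+1 *m x + t *: delta_mx e' 0).
  by rewrite mulmxDr mulmxA -scalemxAr -colE.
(* No cell of dimension [i.+1] is added, so [J i.+1] is onto. *)
apply: steq_same_image => y; first by exists (J i.+1 *m y); rewrite mulmxA.
exists (J' *m y); rewrite -mulmxA JJ' // => a.
case/negP; apply: (inj_card_onto (inj _)); rewrite !card_ord rk.
by rewrite [i.+1 == k]eq_sym (negPf nik) eqSS [i == k]eq_sym (negPf ni1k) !addn0.
Qed.

Lemma steq_expansion_collapse (C C' : periodic_complex G) i :
  expansion_collapse_equiv C C' -> steq (pc_bd C i.+1) (pc_bd C' i.+1).
Proof.
elim=> {C C'} [C C' CC'|C|C C' _ CC'|C C' C'' _ CC' _ CC''].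
- exact: steq_expansion.
- exact: steq_refl.
- exact: steq_sym.
- exact: steq_trans CC' CC''.
Qed.

End Expansions.

(** * Comparison of the two complexes *)

(** Free modules are projective: basis vectors are lifted one by one. The scalar action is a bare
    function [act], so [S] needs no module structure. *)
Lemma presentation_lift (A : comNzRingType) (S : zmodType) (act : A -> S -> S) m m'
    (rho : 'cV[A]_m -> S) (rho' : 'cV[A]_m' -> S) :
  {morph rho : x y / x - y} -> {morph rho' : x y / x - y} ->
  (forall a x, rho (a *: x) = act a (rho x)) ->
  (forall a x, rho' (a *: x) = act a (rho' x)) ->
  (forall s, exists x, rho x = s) ->
  exists V : 'M[A]_(m, m'), forall x, rho (V *m x) = rho' x.
Proof.
move=> rB rB' rZ rZ' onto.
have /fin_all_exists[v Hv] : forall k : 'I_m', exists v, rho v = rho' (delta_mx k 0).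
  by move=> k; apply: onto.
exists (\matrix_(i, k) v k i 0) => x.
have -> : \matrix_(i, k) v k i 0 *m x = \sum_k x k 0 *: v k.
  apply/colP => i; rewrite !mxE summxE; apply: eq_bigr => k _.
  by rewrite !mxE mulrC.
rewrite [in RHS](_ : x = \sum_k x k 0 *: delta_mx k 0); last first.
  by rewrite [LHS]matrix_sum_delta; apply: eq_bigr => k _; rewrite big_ord1.
rewrite (big_morph rho (morphBD rB) (morphB0 rB)).
rewrite (big_morph rho' (morphBD rB') (morphB0 rB')).
by apply: eq_bigr => k _; rewrite rZ rZ' Hv.
Qed.

Lemma mxsubE (U : zmodType) m n (M N : 'M[U]_(m, n)) i j : (M - N) i j = M i j - N i j.
Proof. by rewrite !mxE. Qed.

Lemma mxscaleE (A : comNzRingType) m n a (M : 'M[A]_(m, n)) i j : (a *: M) i j = a * M i j.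
Proof. by rewrite mxE. Qed.

(** * The first Koszul differential *)

Section KoszulDegreeOne.
Variables (R : comNzRingType) (D : nat) (f : 'I_D -> R).

Lemma kosz_basis0 : set0 \in kosz_basis D 0.
Proof. by rewrite inE cards0. Qed.

Definition kosz_ord0 : 'I_(kosz_rank D 0) := enum_rank_in kosz_basis0 set0.

Lemma enum_kosz_ord0 : enum_val kosz_ord0 = set0.
Proof. by rewrite enum_rankK_in // kosz_basis0. Qed.

Lemma kosz_ord0E i : i = kosz_ord0.
Proof.
apply: enum_val_inj; rewrite enum_kosz_ord0; apply/eqP.
by rewrite -cards_eq0 kosz_basis_card.
Qed.

Lemma kbd_set0 g : kbd f g set0 = \sum_a f a * g [set a].
Proof.
rewrite /kbd big_mkcond; apply: eq_bigr => a _; rewrite inE /= setU0.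
rewrite /kosz_sign (_ : [set _ in _ | _] = set0) ?cards0 ?mul1r //.
by apply/setP => k; rewrite !inE.
Qed.

Lemma koszul1_image (z : 'cV[R]_(kosz_rank D 0)) :
  (exists y, z = koszul f 1 *m y) <-> in_ideal f (z kosz_ord0 0).
Proof.
split=> [[y ->]|[g zg]].
  exists (fun a => kosz_fun y [set a]).
  rewrite -kbd_kosz_fun enum_kosz_ord0 kbd_set0.
  by apply: eq_bigr => a _; rewrite mulrC.
pose h A := \sum_a g a *+ (A == [set a]).
exists (\col_t h (enum_val t)); apply/colP => i; rewrite (kosz_ord0E i) zg.
have -> : \sum_k g k * f k = kbd f h set0.
  rewrite kbd_set0; apply: eq_bigr => a _; rewrite /h (bigD1 a) //= eqxx mulr1n.
  rewrite big1 ?addr0 1?mulrC // => b nb.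
  by rewrite (inj_eq set1_inj) eq_sym (negPf nb).
rewrite kbd_coef mxE (sum_kosz_basis (i := 1)) => [|A nA]; last first.
  by rewrite kosz_coef_card ?mul0r // cards0.
by apply: eq_bigr => t _; rewrite !mxE enum_kosz_ord0.
Qed.

(** Injectivity can be read off the entry f_0 alone: no generator precedes it, so regularity says
    that it is a non-zero-divisor. *)
Lemma koszul1_tr_exact : regular_sequence f -> (0 < D)%N ->
  exact_pair (koszul f 1)^T (0 : 'M_(kosz_rank D 0, 0)).
Proof.
move=> rf D0 z; split=> [dz|[y ->]]; last by rewrite mul0mx mulmx0.
exists 0; rewrite mulmx0; apply/colP => i; rewrite (kosz_ord0E i) mxE.
pose a := Ordinal D0.
have a1 : [set a] \in kosz_basis D 1 by rewrite inE cards1.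
have /colP/(_ (enum_rank_in a1 [set a])) := dz.
rewrite !mxE (bigD1 kosz_ord0) //= big1 ?addr0 => [|k /eqP[]]; last exact: kosz_ord0E.
rewrite !mxE enum_kosz_ord0 enum_rankK_in // /kosz_coef (big_pred1 a) => [|c]; last first.
  by rewrite inE /=; case: (eqVneq c a) => //= ->; rewrite setDv eqxx.
rewrite /kosz_sign (_ : [set _ in _ | _] = set0) ?cards0 ?mul1r; last first.
  by apply/setP => c; rewrite !inE; case: (eqVneq c a) => //= ->; rewrite ltnn.
move=> fz; have [|g ->] := rf a (z kosz_ord0 0).
  by exists (fun=> 0); rewrite fz big1 // => k _; rewrite mul0r.
by rewrite big_pred0.
Qed.

End KoszulDegreeOne.

Section Presentations.
Variables (K : comNzRingType) (D : nat) (L : zmodClosed 'rV[int]_D) (T : coset_reps L).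
Local Notation R := (laurent K D).
Local Notation A := (galg K (sublattice L)).
Local Notation N := (cr_index T).
Local Notation iota := (@gpush K (sublattice L) 'rV[int]_D \val).
Local Notation o := (kosz_ord0 D).
Implicit Type f : 'I_D -> R.

Lemma res_koszul1_image f (x : 'cV[A]_(\sum_(i < kosz_rank D 0) N)) :
  (exists y, x = res_mx T (koszul f 1) *m y) <-> in_ideal f (ext_cols x o 0).
Proof. by rewrite res_mx_image koszul1_image. Qed.

(** Scalars act on K^Q through the augmentation, so all monomials act as the identity. *)
Definition act_aug Q (a : A) (s : {ffun 'I_Q -> K}) := [ffun i => gaug a * s i].

Definition toric_aug Q (x : 'cV[A]_(\sum_(i < Q) \sum_(i < kosz_rank D 0) N)) :=
  [ffun i => gaug (ext_cols (submxcol x i) o 0)].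

Lemma toric_augB Q : {morph @toric_aug Q : x y / x - y}.
Proof.
by move=> x y; apply/ffunP => i; rewrite !ffunE submxcolB ext_colsB mxsubE gaugB.
Qed.

Lemma toric_augZ Q a x : @toric_aug Q (a *: x) = act_aug a (toric_aug x).
Proof.
apply/ffunP => i; rewrite !ffunE.
have -> : submxcol (a *: x) i = a *: submxcol x i by apply/matrixP => s t; rewrite !mxE.
by rewrite ext_colsZ mxscaleE gaugM gaug_gpush.
Qed.

Lemma toric_aug_onto Q s : exists x, @toric_aug Q x = s.
Proof.
have /fin_all_exists[x Hx] : forall i, exists x : 'cV[A]_(\sum_(i < kosz_rank D 0) N),
    ext_cols x = const_mx (<< s i *g 0 >> : R).
  by move=> i; apply: ext_cols_onto.
exists (\mxcol_i x i); apply/ffunP => i.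
by rewrite ffunE mxcolK Hx mxE gaugU.
Qed.

Lemma toric_aug_kernel Q x : @toric_aug Q x = 0 <->
  exists y, x = diag_copies Q (res_mx T (koszul (toric_seq K) 1)) *m y.
Proof.
rewrite diag_copies_image; split=> [/ffunP x0 i|H].
  by apply/res_koszul1_image/in_toric_ideal; have := x0 i; rewrite !ffunE.
by apply/ffunP => i; rewrite !ffunE; apply/in_toric_ideal/res_koszul1_image/H.
Qed.

Variables (f : 'I_D -> R) (Q : nat).
Hypothesis hQ : quotient_free_rank f Q.
Hypothesis triv : forall v, v \in L -> quotient_trivial_translation f v.

(** The coordinates of a class of S in the given basis. Triviality of the translations in [L] is
    what makes them compatible with [act_aug]. *)
Lemma quotient_coordinates : exists2 coef : R -> {ffun 'I_Q -> K},
  {morph coef : r s / r - s} /\ (forall s, exists r, coef r = s) &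
  (forall r, coef r = 0 <-> in_ideal f r) /\
  (forall a r, coef (iota a * r) = act_aug a (coef r)).
Proof.
have [b bP] := hQ.
pose lin (c : {ffun 'I_Q -> K}) := \sum_i c i *: b i.
have linB c d : lin (c - d) = lin c - lin d.
  by rewrite -sumrB; apply: eq_bigr => i _; rewrite !ffunE scalerBl.
have {bP}[coef coefP] : exists coef : R -> {ffun 'I_Q -> K},
    forall r c, coef r = c <-> in_ideal f (r - lin c).
  (* A description axiom turns the unique existence of coordinates into a function. *)
  have H r : {c | unique (fun c : {ffun 'I_Q -> K} => in_ideal f (r - lin c)) c}.
    by apply: constructive_indefinite_description; apply: bP.
  exists (fun r => sval (H r)) => r c; case: (H r) => /= c' [c'r uc'].
  by split=> [<-|/uc'].
have coefI r : in_ideal f (r - lin (coef r)) by apply/coefP.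
have coefB : {morph coef : r s / r - s}.
  move=> r s; apply/coefP; rewrite linB.
  have -> : r - s - (lin (coef r) - lin (coef s)) =
      (r - lin (coef r)) - (s - lin (coef s)).
    by rewrite !opprB addrACA [RHS]addrACA [- s + _]addrC.
  by apply/in_idealP/ideal_belowB; apply/in_idealP.
exists coef; split=> //.
- move=> s; exists (lin s); apply/coefP; rewrite subrr.
  exact/in_idealP/ideal_below0.
- move=> r; rewrite coefP (_ : lin 0 = 0) ?subr0 //.
  by apply: big1 => i _; rewrite ffunE scale0r.
move=> a r; move: a; apply: galg_ext => [a a'|a a'|c l].
- by rewrite rmorphB mulrBl coefB.
- by apply/ffunP => i; rewrite !ffunE gaugB mulrBl.
rewrite gpushU; apply/coefP.
have -> : lin (act_aug << c *g l >> (coef r)) = (<< c *g 0 >> : R) * lin (coef r).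
  rewrite -galg_scaleE scaler_sumr; apply: eq_bigr => i _.
  by rewrite ffunE gaugU scalerA.
have -> : (<< c *g \val l >> : R) = (<< c *g 0 >> : R) * mon K (\val l).
  by rewrite monE galgUU mulr1 add0r.
rewrite -mulrA -mulrBr; apply/in_idealP/ideal_belowM.
(* The first summand lies in the ideal by triviality of the translation, the second by the choice of
   coordinates. *)
have -> : mon K (\val l) * r - lin (coef r) =
    (mon K (\val l) - 1) * r + (r - lin (coef r)).
  by rewrite mulrBl mul1r addrA subrK.
by apply: ideal_belowD; apply/in_idealP; [apply: (triv (valP l)) | apply: coefI].
Qed.

(** Both matrices present K^Q with trivial action of [L], the first through the coordinates [coef],
    the second through the augmentation. *)
Lemma koszul1_steq : steq (res_mx T (koszul f 1))
  (diag_copies Q (res_mx T (koszul (toric_seq K) 1))).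
Proof.
have [coef [coefB coef_onto] [coef0 coefZ]] := quotient_coordinates.
pose rho (x : 'cV[A]_(\sum_(i < kosz_rank D 0) N)) := coef (ext_cols x o 0).
have rhoB : {morph rho : x y / x - y}.
  by move=> x y; rewrite /rho ext_colsB mxsubE coefB.
have rhoZ a x : rho (a *: x) = act_aug a (rho x).
  by rewrite /rho ext_colsZ mxscaleE coefZ.
have rho_onto s : exists x, rho x = s.
  have [r <-] := coef_onto s; have [x Hx] := ext_cols_onto T (const_mx r : 'cV_(kosz_rank D 0)).
  by exists x; rewrite /rho Hx mxE.
have [V HV] := presentation_lift rhoB (@toric_augB Q) rhoZ (@toric_augZ Q) rho_onto.
have [U HU] := presentation_lift (@toric_augB Q) rhoB (@toric_augZ Q) rhoZ (@toric_aug_onto Q).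
apply: (steq_presentation rhoB (@toric_augB Q) _ (@toric_aug_kernel Q) HV HU) => x.
by rewrite res_koszul1_image -coef0.
Qed.

End Presentations.

Lemma steq_res_dag (K : comNzRingType) (V : zmodType) (L : zmodClosed V)
    (T : coset_reps L) Q m n m' n'
    (M : 'M[galg K V]_(m, n)) (N : 'M[galg K V]_(m', n')) :
  steq (res_mx T (dag M)) (diag_copies Q (res_mx T (dag N))) <->
  steq (res_mx T M) (diag_copies Q (res_mx T N)).
Proof.
rewrite (res_mx_dag T M) (res_mx_dag T N) -dag_diag_copies.
by split=> [/steq_dag|]; [rewrite !dagK | apply: steq_dag].
Qed.

(** * Transfer between degrees and the equivalence criterion *)

Section Main.
Variables (K : comNzRingType) (D : nat) (L : zmodClosed 'rV[int]_D) (T : coset_reps L).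
Variables (f : 'I_D -> laurent K D) (rf : regular_sequence f) (Q : nat).
Local Notation tor := (@toric_seq D K).

Lemma steq_koszul_up i :
  steq (res_mx T (koszul f 1)) (diag_copies Q (res_mx T (koszul tor 1))) ->
  steq (res_mx T (koszul f i.+1)) (diag_copies Q (res_mx T (koszul tor i.+1))).
Proof.
move=> H; elim: i => [//|i]; apply: steq_kernel.
  exact/exact_res_mx/koszul_exact.
exact/exact_diag_copies/exact_res_mx/koszul_exact/toric_seq_regular.
Qed.

(** In the dual complexes the kernel of each differential is the image of the one of lower degree,
    so [steq_kernel] lowers the degree by one at each step. *)
Lemma steq_koszul_down i : (i < D)%N ->
  steq (res_mx T (dag (koszul f i.+1))) (diag_copies Q (res_mx T (dag (koszul tor i.+1)))) ->
  steq (res_mx T (dag (koszul f 1))) (diag_copies Q (res_mx T (dag (koszul tor 1)))).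
Proof.
elim: i => [//|i IH] iD H; apply: IH; first exact: ltnW.
move: H; apply: steq_kernel.
  exact/exact_res_mx/exact_dag/koszul_tr_exact.
exact/exact_diag_copies/exact_res_mx/exact_dag/koszul_tr_exact/iD/toric_seq_regular.
Qed.

Lemma steq_koszul_trivial v : (0 < D)%N -> v \in L ->
  steq (res_mx T (koszul f 1)) (diag_copies Q (res_mx T (koszul tor 1))) ->
  quotient_trivial_translation f v.
Proof.
move=> D0 vL H s; pose l : sublattice L := Sublattice vL.
(* On the toric side x^l - 1 has augmentation 0 and annihilates the whole presented module, not only
   the classes invisible to functionals. *)
have kt : kills_torsion (mon K l - 1) (diag_copies Q (res_mx T (koszul tor 1))).
  move=> x _; apply/toric_aug_kernel; rewrite toric_augZ; apply/ffunP => i.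
  by rewrite ffunE gaug_mon_sub1 mul0r ffunE.
have [x Hx] := ext_cols_onto T (const_mx s : 'cV[laurent K D]_(kosz_rank D 0)).
have [c cM|y Hy] := kills_torsion_steq H kt (x := x); last first.
  have /res_koszul1_image : exists y, (mon K l - 1) *: x = res_mx T (koszul f 1) *m y.
    by exists y.
  rewrite ext_colsZ mxscaleE Hx mxE.
  by rewrite rmorphB rmorph1 /= gpush_mon.
(* A functional killing the image of the first differential must vanish: its dagger lies in the
   kernel of the dual differential, which is injective. *)
suff -> : c = 0 by rewrite mul0mx.
have : exact_pair (dag (koszul f 1)) (map_mx (@gbar K _) (0 : 'M_(kosz_rank D 0, 0))).
  by rewrite /dag map_trmx; apply/exact_gbar/koszul1_tr_exact.
move/(exact_res_mx (T := T))/(_ (dag c)); rewrite map_mx0 res_mx0 res_mx_dag -dagM cM.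
case=> [] [|y cy _]; first by rewrite /dag map_mx0 trmx0.
by rewrite -[c]dagK cy mul0mx /dag map_mx0 trmx0.
Qed.

End Main.

Lemma realization_steq (K : comNzRingType) D (L : zmodClosed 'rV[int]_D)
    (T : coset_reps L) j (TC : css_code K (sublattice L)) :
  toric_code_realization T j.+1 TC ->
  steq (res_mx T (dag (koszul (toric_seq K) j.+1))) (cs_X TC).
Proof.
move=> [C hC ->]; have /(steq_map (@gcoef K _))/steq_dag := steq_expansion_collapse j hC.
by have := hypercubic_X T K j.+1; rewrite /= => ->.
Qed.

Lemma koszul_code_equiv_toric (K : comNzRingType) D (f : 'I_D -> laurent K D)
    (L : zmodClosed 'rV[int]_D) (T : coset_reps L) Q j (TC : css_code K (sublattice L)) :
  regular_sequence f -> quotient_free_rank f Q -> (j < D)%N ->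
  toric_code_realization T j.+1 TC ->
  steq (res_mx T (dag (koszul f j.+1))) (diag_copies Q (cs_X TC)) <->
  (forall v, v \in L -> quotient_trivial_translation f v).
Proof.
move=> rf hQ jD hTC; have TCQ := steq_diag_copies Q (realization_steq hTC).
have D0 : (0 < D)%N := leq_ltn_trans (leq0n j) jD.
split=> [H v vL|triv].
  have H1 := steq_koszul_down rf jD (steq_trans H (steq_sym TCQ)).
  have [H2 _] := steq_res_dag T Q (koszul f 1) (koszul (toric_seq K) 1).
  have H3 := H2 H1.
  exact: (steq_koszul_trivial rf D0 vL H3).
apply: steq_trans TCQ; have [_] := steq_res_dag T Q (koszul f j.+1) (koszul (toric_seq K) j.+1).
apply; exact: (steq_koszul_up rf j (koszul1_steq T hQ triv)).
Qed.

Theorem corollary5 (D p m : nat) (hD : (2 <= D)%N) (hp : prime p) (hm : (1 <= m)%N)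
    (f : 'I_D -> laurent 'Z_(p ^ m) D) (hf : regular_sequence f)
    (Q : nat) (hQ : quotient_free_rank f Q)
    (j : nat) (hj : (1 <= j <= D.-1)%N)
    (Lambda : zmodClosed 'rV[int]_D) (T : coset_reps Lambda)
    (TC : css_code 'Z_(p ^ m) (sublattice Lambda))
    (hTC : toric_code_realization T j TC)
    (htriv : trivial_superselection_layer j TC) :
  code_equiv (res_code T (koszul_code f j)) (css_copies Q TC) <->
  (forall v : 'rV[int]_D, v \in Lambda -> quotient_trivial_translation f v).
Proof.
case: j hj hTC {htriv} => [//|j] /andP[_ jD] hTC.
apply: iff_trans (stable_clifford_equivP _ _) _.
exact: koszul_code_equiv_toric hf hQ (leq_trans jD (leq_pred D)) hTC.
Qed.
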